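(* Let $F$ be a face of the Coxeter fan of $W_0$, let $f$ lie in the relative interior of $F$, let $\Phi'$ be a union of indecomposable components of $\Phi_F$, and put $B(F,\Phi')=\{\beta\in\Phi^+:\langle f,\beta\rangle<0\}\cup(\Phi'\cap\Phi^+)$. Then the set of biclosed subsets of $\Phi^+$ commensurable with $B(F,\Phi')$ is exactly the $W_F$-orbit of $B(F,\Phi')$ under the action $w\cdot B=\{|w\gamma|:\gamma\in B\}\oplus N(w)$, and $W_F$ acts freely on this orbit.
   Context: Setup: $\Phi_0$ is a finite, indecomposable, crystallographic root system in $V_0$ with positive roots $\Phi_0^+$, highest root $\theta$, Weyl group $W_0$. $V=V_0\oplus\mathbb{R}\delta$, $\Phi=\{\alpha+k\delta:\alpha\in\Phi_0,k\in\mathbb{Z}\}$, $\Phi^+=\Phi_0^+\cup\{\alpha+k\delta:\alpha\in\Phi_0,k\ge1\}$, and $W$ is the affine Weyl group generated by reflections in the simple roots $\alpha_1,\dots,\alpha_n,\delta-\theta$. $N(w)=\{\beta\in\Phi^+:w^{-1}\beta\in-\Phi^+\}$. For a root $\phi$, $|\phi|$ is $\phi$ if $\phi\in\Phi^+$ and $-\phi$ otherwise; $\oplus$ is symmetric difference. Two sets are commensurable if their symmetric difference is finite. $B\subseteq\Phi^+$ is biclosed if for $\alpha,\beta,\gamma\in\Phi^+$ with $\gamma\in\mathbb{R}_{>0}\alpha+\mathbb{R}_{>0}\beta$: $\alpha,\beta\in B\Rightarrow\gamma\in B$ and $\alpha,\beta\notin B\Rightarrow\gamma\notin B$. The Coxeter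 fan of $W_0$ in $V_0^\vee$ has chambers the $W_0$-translates of the dominant chamber and faces all intersections of chambers (including $\{0\}$); $V_0^\vee$ is identified with functionals on $V$ vanishing on $\delta$, on which $W$ acts via $W\to W_0$. For a face $F$ with $f$ in its relative interior, $W_F$ is the stabilizer of $F$ in $W$, $\Phi_F=\{\beta\in\Phi:\langle f,\beta\rangle=0\}$, and the components of $\Phi_F$ are the mutually orthogonal indecomposable subsystems into which it uniquely decomposes.
   Formalization: With W_F the stabilizer of F in W, freeness fails for F ≠ {0} (some translations in W_F fix B(F,Φ')). The orbit claim is proved for W_F and also for the group generated by reflections in the roots of Φ_F; freeness is proved for that latter group. *)

(* Defs.v *)
From HB Require Import structures.
From mathcomp Require Import all_boot all_order all_algebra sesquilinear.
From mathcomp Require Import boolp classical_sets cardinality reals.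

Set Implicit Arguments.
Unset Strict Implicit.
Unset Printing Implicit Defensive.

Import Order.TTheory GRing.Theory Num.Theory.
Local Open Scope classical_set_scope.
Local Open Scope ring_scope.

Section Generic.
Context {R : realType} {U : vectType R}.
Implicit Types (b : U -> U -> R) (S A B : set U).

Definition refl b (beta : U) : 'End(U) :=
  linfun (fun x => x - (2 * b x beta / b beta beta) *: beta).

Inductive generated (S : set 'End(U)) : set 'End(U) :=
| generated_id : generated S \1%VF
| generated_gen g of S g : generated S g
| generated_comp g h of generated S g & generated S h : generated S (g \o h)%VF
| generated_inv g of generated S g : generated S (g^-1)%VF.

Definition refl_group b (S : set U) : set 'End(U) := generated (refl b @` S).

Definition orthogonal_sets b A B := forall x y, A x -> B y -> b x y = 0.

Definition indecomposable b S :=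
  S !=set0 /\
  forall A B, A !=set0 -> B !=set0 -> A `|` B = S -> ~ orthogonal_sets b A B.

Definition is_component b S (Psi : set U) :=
  [/\ Psi `<=` S, indecomposable b Psi & orthogonal_sets b Psi (S `\` Psi)].

Definition union_of_components b S (Psi : set U) :=
  exists2 C : set (set U), C `<=` is_component b S & Psi = \bigcup_(X in C) X.

Definition aff_hull A : set U := [set g | exists (m : nat) (c : 'I_m -> R)
  (h : 'I_m -> U), [/\ forall i, A (h i), \sum_i c i = 1 & g = \sum_i c i *: h i]].

Definition commensurable A B := finite_set (A `+` B).

Definition contragredient (w : 'End(U)) (phi : 'Hom(U, R^o)) : 'Hom(U, R^o) :=
  (phi \o w^-1)%VF.

End Generic.

Section Setup.
Context {R : realType} {V0 : vectType R}.
Variable form : {dot V0 for idfun}.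

Record root_system (Phi0 : set V0) : Prop := RootSystem {
  rs_finite : finite_set Phi0;
  rs_span : forall E : {vspace V0}, (forall a, Phi0 a -> a \in E) -> E = fullv;
  rs_neq0 : ~ Phi0 0;
  rs_refl : forall a b, Phi0 a -> Phi0 b -> Phi0 (refl form a b);
  rs_reduced : forall a c, Phi0 a -> Phi0 (c *: a) -> c = 1 \/ c = -1;
  rs_crystallographic : forall a b, Phi0 a -> Phi0 b ->
    2 * form b a / form a a \is a Num.int }.

Record simple_roots (Phi0 : set V0) n (Delta : n.-tuple V0) : Prop := SimpleRoots {
  sr_basis : basis_of fullv Delta;
  sr_root : forall i, Phi0 (tnth Delta i);
  sr_sign : forall a, Phi0 a ->
    (forall i, coord Delta i a \is a Num.nat) \/
    (forall i, coord Delta i (- a) \is a Num.nat) }.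

Section Affine.
Variables (Phi0 : set V0) (n : nat) (Delta : n.-tuple V0).

Definition pos_roots0 : set V0 :=
  [set a | Phi0 a /\ forall i, 0 <= coord Delta i a].

Definition highest_root (theta : V0) :=
  Phi0 theta /\ forall a i, Phi0 a -> coord Delta i a <= coord Delta i theta.

Definition weyl0 : set 'End(V0) := refl_group form Phi0.

Let V : vectType R := (V0 * R^o)%type.

Definition delta : V := (0, 1).
Definition aff_root (a : V0) (k : int) : V := ((a, 0) : V) + k%:~R *: delta.

(* the invariant form on V, whose radical is spanned by delta *)
Definition aform (x y : V) : R := form x.1 y.1.

Definition roots : set V := [set aff_root a k | a in Phi0 & k in [set: int]].

Definition pos_roots : set V :=
  [set aff_root a 0 | a in pos_roots0] `|`
  [set aff_root a k | a in Phi0 & k in [set k : int | 1 <= k]].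

Definition weyl (theta : V0) : set 'End(V) :=
  refl_group aform
    ([set aff_root (tnth Delta i) 0 | i in [set: 'I_n]] `|`
     [set aff_root (- theta) 1]).

Definition inversions (w : 'End(V)) : set V :=
  [set beta | pos_roots beta /\ pos_roots (- (w^-1)%VF beta)].

Definition root_abs (phi : V) : V := if phi \in pos_roots then phi else - phi.

Definition biclosed (B : set V) :=
  B `<=` pos_roots /\
  forall x y z, pos_roots x -> pos_roots y -> pos_roots z ->
    (exists a b : R, [/\ 0 < a, 0 < b & z = a *: x + b *: y]) ->
    (B x -> B y -> B z) /\ (~ B x -> ~ B y -> ~ B z).

Definition act (w : 'End(V)) (B : set V) : set V :=
  [set root_abs (w g) | g in B] `+` inversions w.

Definition orbit_of (G : set 'End(V)) (B : set V) : set (set V) :=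
  [set act w B | w in G].

Definition acts_freely_on (G : set 'End(V)) (O : set (set V)) :=
  forall w B, G w -> O B -> act w B = B -> w = \1%VF.

(* V0^\vee is 'Hom(V0, R^o); pull f is f seen as a functional on V that
   vanishes on delta *)
Definition pull (f : 'Hom(V0, R^o)) : 'Hom(V, R^o) := linfun (fun x : V => f x.1).

Definition dominant_chamber : set 'Hom(V0, R^o) :=
  [set f | forall i, 0 <= f (tnth Delta i)].

Definition chamber (C : set 'Hom(V0, R^o)) :=
  exists2 w, weyl0 w & C = contragredient w @` dominant_chamber.

Definition fan_face (F : set 'Hom(V0, R^o)) :=
  exists2 K : set (set 'Hom(V0, R^o)),
    K !=set0 /\ K `<=` chamber & F = \bigcap_(C in K) C.

(* Interior of F relative to its affine hull. The values on the basis Delta are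
   linear coordinates on V0^\vee, so the boxes below form a neighbourhood basis
   of f for the usual topology. *)
Definition rel_interior (F : set 'Hom(V0, R^o)) : set 'Hom(V0, R^o) :=
  [set f | F f /\ exists2 e : R, 0 < e & forall g, aff_hull F g ->
     (forall i, `|g (tnth Delta i) - f (tnth Delta i)| < e) -> F g].

Definition face_stabilizer (theta : V0) (F : set 'Hom(V0, R^o)) : set 'End(V) :=
  [set w | weyl theta w /\
           contragredient w @` (pull @` F) = pull @` F].

Definition face_roots (f : 'Hom(V0, R^o)) : set V :=
  [set beta | roots beta /\ pull f beta = 0].

(* face_stabilizer contains every translation of the affine Weyl group, since
   translations act trivially on V0^\vee, so for F <> {0} it does not act freely.
   The subgroup that does is the Weyl group of the root system face_roots f: it
   consists of the elements of the affine Weyl group that fix F pointwise once F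
   is moved into V0, seen as a subspace of V, by means of the form. *)
Definition face_weyl (f : 'Hom(V0, R^o)) : set 'End(V) :=
  refl_group aform (face_roots f).

Definition face_biclosed (f : 'Hom(V0, R^o)) (Phi' : set V) : set V :=
  [set beta | pos_roots beta /\ pull f beta < 0] `|` (Phi' `&` pos_roots).

End Affine.
End Setup.

(* Main.v *)
(* Extend a subset B of Phi+ to the half hat B = B u -(Phi+ \ B) of Phi: the action
   becomes the linear one, hat (w.B) = w (hat B), and B is biclosed iff hat B is
   closed under positive combinations. Off Phi_F, a biclosed set commensurable with
   B(F,Phi') is determined by the sign of f, because each coset a + Z delta lies
   almost entirely in a known half. On Phi_F, exchanging B with its complement outside
   Phi' turns it into a closed half X missing finitely many positive roots. A missing
   root of minimal height is simple, and its reflection decreases the number of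
   missing roots, so some w in the reflection group of Phi_F maps X to the positive
   roots; w is unique by the deletion argument. For the full stabilizer of F, the
   linear part of an element stabilizing F is shown, by the same two facts for
   finite root systems, to be a product of reflections in roots vanishing at f. *)
From HB Require Import structures.
Require Import Defs.
From mathcomp Require Import all_boot all_order all_algebra sesquilinear.
From mathcomp Require Import boolp classical_sets cardinality reals.
From mathcomp Require Import zify ring lra.
Import Order.TTheory GRing.Theory Num.Theory.
Local Open Scope classical_set_scope.
Local Open Scope ring_scope.

Set Implicit Arguments.
Unset Strict Implicit.
Unset Printing Implicit Defensive.

(** One theory of roots, with a semidefinite form and an integral height, serves the finite system,
    the affine system and their sections by [f = 0]. [Phi_F] can be a product of several affine
    systems sharing delta, whose simple roots are then linearly dependent as a whole; so a simple
    root is characterized by its reflection and never as a member of a basis. Exchanging a set with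
    its complement outside [Phi'] respects closure because a root that is a positive combination of
    two roots of [Phi_F] lies in [Phi'] exactly when each of them does. The half or its complement
    is thus used on all three roots at once, and both are closed. Translations make the stabilizer
    of [F] larger than the reflection group of [Phi_F] without enlarging the orbit: every element of
    the stabilizer has a linear part preserving both [f] and [Phi'], so it changes [B(F,Phi')] only
    at finitely many inversions. *)

(** * Linear maps and extremal elements of finite sets *)

Lemma linfun_linE (K : fieldType) (aT rT : vectType K) (g : aT -> rT) :
  linear g -> linfun g =1 g.
Proof.
move=> lin_g.
pose G : {linear aT -> rT} := HB.pack g (GRing.isLinear.Build K aT rT *:%R g lin_g).
exact: (lfunE G).
Qed.

Lemma int_ge1 (R : realType) (x : R) : x \is a Num.int -> 0 < x -> 1 <= x.
Proof. by move=> /intrP[z ->]; rewrite ltr0z ler1z. Qed.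

Lemma seq_argmin (R : realType) (T : eqType) (h : T -> R) (s : seq T) :
  s != [::] -> exists2 x, x \in s & forall y, y \in s -> h x <= h y.
Proof.
elim: s => // x [_ _|y s /(_ isT)[z zs hz] _].
  by exists x => [|y]; rewrite inE // => /eqP->.
have [hxz|hzx] := lerP (h x) (h z).
  exists x => [|u]; first by rewrite mem_head.
  by rewrite inE => /predU1P[->//|/hz]; apply: le_trans.
exists z => [|u]; first by rewrite inE zs orbT.
by rewrite inE => /predU1P[->|/hz//]; apply: ltW.
Qed.

Lemma finite_set_argmin (R : realType) (T : eqType) (h : T -> R) (A : set T) :
  finite_set A -> A !=set0 -> exists2 x, A x & forall y, A y -> h x <= h y.
Proof.
move=> /finite_seqP[s ->] [x0 x0s].
by apply: seq_argmin; case: s x0s.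
Qed.

Lemma finite_set_bound (R : realType) (T : eqType) (h : T -> R) (A : set T) :
  finite_set A -> exists M, forall y, A y -> h y <= M.
Proof.
move=> fin; have [->|/set0P A0] := eqVneq A set0; first by exists 0.
have [y _ hy] := finite_set_argmin (fun y => - h y) fin A0.
by exists (h y) => z /hy; rewrite lerN2.
Qed.

(** * Words of reflections for a semidefinite form *)

Section Word.
Context {R : realType} {U : vectType R} (b : U -> U -> R).

(** Only semidefiniteness is required, since delta spans the radical of the invariant form on
    [V]. *)
Record psd_form : Prop := PsdForm {
  psdD : forall x y z, b (x + y) z = b x z + b y z;
  psdZ : forall c x y, b (c *: x) y = c * b x y;
  psdC : forall x y, b x y = b y x;
  psd_ge0 : forall x, 0 <= b x x }.

Definition word (t : seq U) : 'End(U) := foldr (fun a g => (refl b a \o g)%VF) \1%VF t.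

Hypothesis bP : psd_form.
Implicit Types (x y z a c : U) (s t : seq U).

Lemma bformDl x y z : b (x + y) z = b x z + b y z. Proof. exact: psdD. Qed.
Lemma bformZl k x y : b (k *: x) y = k * b x y. Proof. exact: psdZ. Qed.
Lemma bformDr x y z : b z (x + y) = b z x + b z y.
Proof. by rewrite !(psdC bP z) bformDl. Qed.
Lemma bformZr k x y : b y (k *: x) = k * b y x.
Proof. by rewrite !(psdC bP y) bformZl. Qed.
Lemma bformNl x y : b (- x) y = - b x y.
Proof. by rewrite -scaleN1r bformZl mulN1r. Qed.
Lemma bformNr x y : b y (- x) = - b y x.
Proof. by rewrite -scaleN1r bformZr mulN1r. Qed.
Definition bformE := (bformDl, bformDr, bformNl, bformNr, bformZl, bformZr).

Lemma form_subZ k x a :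
  b (x - k *: a) (x - k *: a) = b x x - 2 * k * b x a + k ^+ 2 * b a a.
Proof. by rewrite !bformE (psdC bP a x); ring. Qed.

Lemma reflE a x : refl b a x = x - (2 * b x a / b a a) *: a.
Proof.
rewrite /refl linfun_linE // => k u v.
rewrite !bformE (_ : 2 * _ / _ = k * (2 * b u a / b a a) + 2 * b v a / b a a).
  by rewrite scalerDl scalerBr scalerA opprD addrACA.
by ring.
Qed.

Lemma refl_id a : b a a != 0 -> refl b a a = - a.
Proof.
by move=> a0; rewrite reflE mulfK // -{1}[a]scale1r -scalerBl -scaleN1r; congr (_ *: _); ring.
Qed.

Lemma reflN a : refl b (- a) = refl b a.
Proof.
apply/lfunP => x; rewrite !reflE !bformE opprK mulrN mulNr scalerN.
by rewrite scaleNr opprK.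
Qed.

Lemma reflK a : b a a != 0 -> involutive (refl b a).
Proof.
move=> a0 x; rewrite {1}reflE reflE !bformE -addrA -opprD -scalerDl.
by rewrite [X in X *: _](_ : _ = 0) ?scale0r ?subr0 //; field.
Qed.

Lemma refl_isom a x y : b a a != 0 -> b (refl b a x) (refl b a y) = b x y.
Proof.
move=> a0; rewrite !reflE !bformE (psdC bP a y); field.
by [].
Qed.

Lemma word_cat s t : word (s ++ t) = (word s \o word t)%VF.
Proof. by elim: s => [|x s IH] /=; rewrite ?comp_lfun1l // IH comp_lfunA. Qed.

Lemma word_cons a s x : word (a :: s) x = refl b a (word s x).
Proof. by rewrite /= comp_lfunE. Qed.

Lemma word_nil x : word [::] x = x.
Proof. by rewrite /= id_lfunE. Qed.

Lemma word_catE s t x : word (s ++ t) x = word s (word t x).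
Proof. by rewrite word_cat comp_lfunE. Qed.

Lemma word_seq1 a : word [:: a] = refl b a.
Proof. by rewrite /= comp_lfun1r. Qed.

Definition anisotropic (S : set U) := forall x, S x -> 0 < b x x.
Definition letters (S : set U) t := forall x, x \in t -> S x.

Lemma letters_cons S a t : letters S (a :: t) <-> S a /\ letters S t.
Proof.
split=> [St|[Sa St] x]; last by rewrite inE => /predU1P[->|/St].
by split=> [|x xt]; apply: St; rewrite inE ?eqxx // xt orbT.
Qed.

Lemma letters_cat S s t : letters S (s ++ t) <-> letters S s /\ letters S t.
Proof.
split=> [St|[Ss St] x]; last by rewrite mem_cat => /orP[/Ss|/St].
by split=> x xt; apply: St; rewrite mem_cat xt ?orbT.
Qed.

Lemma letters_rev S t : letters S t -> letters S (rev t).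
Proof. by move=> St x; rewrite mem_rev; apply: St. Qed.

Lemma letters_sub S T t : S `<=` T -> letters S t -> letters T t.
Proof. by move=> ST St x /St/ST. Qed.

Section Aniso.
Variable S : set U.
Hypothesis S0 : anisotropic S.

Lemma aniso_neq0 a : S a -> b a a != 0.
Proof. by move=> /S0/lt0r_neq0. Qed.

Lemma word_isom t x y : letters S t -> b (word t x) (word t y) = b x y.
Proof.
elim: t => [|a t IH]; first by rewrite !word_nil.
by move=> /letters_cons[Sa /IH e]; rewrite !word_cons refl_isom ?aniso_neq0.
Qed.

Lemma word_revK t : letters S t -> cancel (word t) (word (rev t)).
Proof.
elim: t => [|a t IH] => [_ x|/letters_cons[Sa St] x]; first by rewrite !word_nil.
by rewrite rev_cons -cats1 word_catE word_seq1 word_cons reflK ?IH ?aniso_neq0.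
Qed.

Lemma word_revVK t : letters S t -> cancel (word (rev t)) (word t).
Proof. by move=> /letters_rev/word_revK; rewrite revK. Qed.

(** The pseudo-inverse of a linear map is a true inverse once the kernel is trivial, which the
    reversed word provides. *)
Lemma word_inv t : letters S t -> (word t)^-1%VF = word (rev t).
Proof.
move=> St; have k0 : lker (word t) == 0%VS by apply/lker0P/can_inj/word_revK.
apply/lfunP => x; apply: (lker0P k0).
by rewrite (lker0_lfunVK k0) word_revVK.
Qed.

Lemma generated_word t : letters S t -> refl_group b S (word t).
Proof.
elim: t => [_|a t IH /letters_cons[Sa /IH St]]; first exact: generated_id.
by apply: generated_comp => //; apply: generated_gen; exists a.
Qed.

Lemma refl_groupP w : refl_group b S w -> exists2 t, letters S t & w = word t.
Proof.
elim=> [|g [a Sa <-]|g h _ [s Ss ->] _ [t St ->]|g _ [t St ->]].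
- by exists [::].
- by exists [:: a]; rewrite ?word_seq1 // => x; rewrite inE => /eqP->.
- by exists (s ++ t); [apply/letters_cat | rewrite word_cat].
- by exists (rev t); [apply: letters_rev | rewrite word_inv].
Qed.

(** This is [w s_a w^-1 = s_(w a)], written without inverses. *)
Lemma refl_conj t a x : letters S t ->
  word t (refl b a x) = refl b (word t a) (word t x).
Proof. by move=> St; rewrite !reflE linearB linearZ /= !word_isom. Qed.

End Aniso.
End Word.

(** * Graded root systems, closed halves and simple roots *)

Section Roots.
Context {R : realType} {U : vectType R}.
Implicit Types (b : U -> U -> R) (Psi S X : set U) (h : 'Hom(U, R^o)).

(* [b] may be degenerate, so [gr_reduced] and [gr_inj] compare roots modulo the radical;
   positivity of roots is the sign of the height [h]. *)
Record graded_roots b Psi h : Prop := GradedRoots {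
  gr_form : psd_form b;
  gr_aniso : anisotropic b Psi;
  gr_refl : forall a x, Psi a -> Psi x -> Psi (refl b a x);
  gr_int : forall a x, Psi a -> Psi x -> 2 * b x a / b a a \is a Num.int;
  gr_reduced : forall x y c, Psi x -> Psi y ->
    b (x - c *: y) (x - c *: y) = 0 -> c = 1 \/ c = -1;
  gr_inj : forall x y, Psi x -> Psi y -> b (x - y) (x - y) = 0 -> h x = h y -> x = y;
  gr_height_int : forall x, Psi x -> h x \is a Num.int;
  gr_height_neq0 : forall x, Psi x -> h x != 0 }.

Definition pos Psi h : set U := [set x | Psi x /\ 0 < h x].

(** The defining property is the one that descent and deletion use: the reflection makes no other
    positive root negative. *)
Definition simple b Psi h : set U := [set a | pos Psi h a /\
  forall x, pos Psi h x -> x <> a -> pos Psi h (refl b a x)].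

Record closed_half Psi X : Prop := ClosedHalf {
  chN : forall x, Psi x -> X (- x) <-> ~ X x;
  ch_closed : forall x y z k l, Psi x -> Psi y -> Psi z -> X x -> X y ->
    0 < k -> 0 < l -> z = k *: x + l *: y -> X z }.

Section Theory.
Variables (b : U -> U -> R) (Psi : set U) (h : 'Hom(U, R^o)).
Hypothesis gr : graded_roots b Psi h.
Let bP := gr_form gr.
Let an := gr_aniso gr.
Local Notation P := (pos Psi h).
Local Notation s_ := (refl b).
Implicit Types (x y z a c : U) (s t : seq U) (k l : R).

Lemma root_opp x : Psi x -> Psi (- x).
Proof.
move=> Px; have := gr_refl gr Px Px; rewrite refl_id //; exact: aniso_neq0 an _ Px.
Qed.

Lemma root_oppE x : Psi (- x) <-> Psi x.
Proof. by split=> [/root_opp|/root_opp//]; rewrite opprK. Qed.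

Lemma pos_root x : P x -> Psi x. Proof. by case. Qed.

Lemma posN x : Psi x -> P (- x) <-> ~ P x.
Proof.
move=> Px; split=> [[_ + [_]]|nPx]; first by rewrite linearN /=; lra.
split; first exact: root_opp.
rewrite linearN /= oppr_gt0 ltNge le_eqVlt negb_or eq_sym (gr_height_neq0 gr Px) /=.
by apply/negP => hx; apply: nPx.
Qed.

Lemma pos_dichotomy x : Psi x -> P x \/ P (- x).
Proof. by move=> Px; have [|/(posN Px)] := pselect (P x); [left | right]. Qed.

Lemma pos_closed_half : closed_half Psi P.
Proof.
split=> [x|x y z k l Px Py Pz [_ hx] [_ hy] k0 l0 ze]; first exact: posN.
split=> //; rewrite ze linearD !linearZ /=.
by apply: addr_gt0; apply: mulr_gt0.
Qed.

Lemma simple_root a : simple b Psi h a -> Psi a. Proof. by case=> -[]. Qed.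

Lemma simple_neg a x : simple b Psi h a -> P x -> ~ P (s_ a x) -> x = a.
Proof. by move=> [_ sa] Px; apply: contra_notP => /sa; apply. Qed.

Lemma word_root t x : letters Psi t -> Psi x -> Psi (word b t x).
Proof.
elim: t x => [|a t IH] x; first by rewrite word_nil.
by move=> /letters_cons[Pa Pt] Px; rewrite word_cons; apply: (gr_refl gr) => //; apply: IH.
Qed.

Lemma word_rootE t x : letters Psi t -> Psi (word b t x) <-> Psi x.
Proof.
move=> Pt; split=> [|Px]; last exact: word_root.
by move=> /(word_root (letters_rev Pt)); rewrite (word_revK bP an).
Qed.

Lemma closed_half_word X t : letters Psi t -> closed_half Psi X ->
  closed_half Psi [set x | X (word b t x)].
Proof.
move=> Pt [XN Xc]; split=> [x Px|x y z k l Px Py Pz Xx Xy k0 l0 ze] /=.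
  by rewrite linearN; apply/XN/word_root.
apply: (Xc (word b t x) (word b t y)) k0 l0 _ => //; try exact: word_root.
by rewrite ze linearD !linearZ.
Qed.

(* A root of [P \ X] of minimal height is simple: otherwise it would be a sum of
   two roots of [P], one of them lower and outside [X]. Affine root systems only
   allow a weaker splitting [2 a = (a - e) + (a + e)] with [e] in the radical, which
   the finiteness of [P \ X] excludes. *)
Section Minimal.
Variable X : set U.
Hypothesis chX : closed_half Psi X.
Let N := P `\` X.
Hypothesis finN : finite_set N.
Variable a : U.
Hypotheses (Na : N a) (mina : forall y, N y -> h a <= h y).

Let Pa : P a. Proof. by case: Na. Qed.
Let Ra : Psi a. Proof. by case: Pa. Qed.

Lemma min_below x : P x -> h x < h a -> X x.
Proof.
move=> Px hx; apply: contrapT => nXx.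
by have := mina (conj Px nXx); rewrite leNgt hx.
Qed.

(** Each summand is lower than [a], hence lies in [X]; closure would then put [a] in [X]. *)
Lemma min_indecomposable x y : P x -> P y -> a <> x + y.
Proof.
move=> Px Py e; case: Na => _; apply.
have ha : h a = h x + h y by rewrite e linearD.
have [[Rx hx] [Ry hy]] := (Px, Py).
apply: (ch_closed chX Rx Ry Ra (k := 1) (l := 1)); rewrite ?scale1r ?ltr01 //.
- by apply: min_below => //; rewrite ha ltrDl.
- by apply: min_below => //; rewrite ha ltrDr.
Qed.

(** Otherwise moving [x] along the isotropic vector [e] changes its norm linearly and without bound;
    the multiple [k] is chosen to make the norm equal to [- b x x - 2]. *)
Lemma radical_orth e x : b e e = 0 -> b e x = 0.
Proof.
move=> e0; apply/eqP/negPn/negP => ex0.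
have := psd_ge0 bP (x - ((b x x + 1) / b e x) *: e).
set k := _ / _; have kE : k * b e x = b x x + 1 by rewrite divfK.
rewrite form_subZ // e0 mulr0 addr0 (psdC bP x e) -mulrA kE.
by have := psd_ge0 bP x; lra.
Qed.

(* By minimality of [a], [a - e] lies in [X]; then so does every
   [-(a + m e) = m (a - e) + (m + 1) (-a)], and [N] contains the whole ray [a + m e]. *)
Lemma min_no_radical e : Psi (a - e) -> b e e = 0 -> 0 < h e ->
  P (a - e) -> Psi (a + e) -> False.
Proof.
move=> Rae e0 he Pae Rape.
have Xae : X (a - e) by apply: min_below => //; rewrite linearB /= ltrBlDr ltrDl.
have XNa : X (- a) by apply/(chN chX) => //; case: Na.
have rad x : b e x = 0 by exact: radical_orth.
have rad' x : b x e = 0 by rewrite (psdC bP).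
have ba0 := aniso_neq0 an Ra.
(* Two consecutive roots of the ray produce the next: modulo the radical both equal [a], so
   reflecting [a + m e] in [a + (m + 1) e] subtracts twice the latter. *)
have Rm (m : nat) : Psi (a + m%:R *: e) /\ Psi (a + m.+1%:R *: e).
  elim: m => [|m [IH1 IH2]]; first by rewrite scale0r addr0 scale1r.
  split=> //; apply/root_oppE.
  suff -> : - (a + m.+2%:R *: e) = s_ (a + m.+1%:R *: e) (a + m%:R *: e).
    exact: (gr_refl gr).
  rewrite reflE // !(bformE bP) !rad !rad' !mulr0 !addr0 mulfK //.
  rewrite scalerDr scalerA [- (2 *: a + _)]opprD [RHS]addrACA -scalerBl.
  rewrite -[X in X - 2 *: a]scale1r -scalerBl.
  by rewrite opprD -scaleN1r -scaleNr; congr (_ *: _ + _ *: _); ring.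
have Nm (m : nat) : N (a + m.+1%:R *: e).
  have [_ Rm1] := Rm m; split.
    split=> //; rewrite linearD linearZ /= addr_gt0 //; first by case: Pa.
    by rewrite mulr_gt0 // ltr0n.
  apply/(chN chX) => //.
  apply: (ch_closed chX Rae (root_opp Ra) (root_opp Rm1) Xae XNa
            (k := m.+1%:R) (l := m.+2%:R)); rewrite ?ltr0n //.
  rewrite scalerN scalerBr opprD addrAC -scalerBl; congr (_ - _).
  by rewrite -[LHS]scaleN1r; congr (_ *: _); ring.
(* Minimizing [- h] picks a highest element [y] of [N]; the index on the ray is taken just large
   enough to pass the height of [y]. *)
have [y _ miny] := finite_set_argmin (fun x => - h x) finN (ex_intro _ a Na).
have := miny _ (Nm (Num.truncn ((h y - h a) / h e))).
rewrite lerN2 linearD linearZ /= -lerBrDl -ler_pdivlMr // leNgt.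
by rewrite truncnS_gt.
Qed.

(* With [c] and [d] the Cartan integers of [a] and [x], [c d <= 4]; both [x] and
   [x' = c a - x] are positive. *)
Lemma min_simple : simple b Psi h a.
Proof.
split=> // x Px xa; apply: contrapT => nPx.
have [Rx hx] := Px; have [_ ha] := Pa.
pose x' := - s_ a x; pose c := 2 * b x a / b a a; pose d := 2 * b a x / b x x.
have Px' : P x' by apply/posN => //; apply: (gr_refl gr).
have [Rx' hx'] := Px'.
have x'E : x' = c *: a - x by rewrite /x' reflE // opprB.
have baa : 0 < b a a by exact: an.
have bxx : 0 < b x x by exact: an.
have cE : c * b a a = 2 * b x a by rewrite /c divfK // gt_eqF.
have dE : d * b x x = 2 * b x a by rewrite /d divfK ?gt_eqF // (psdC bP a).
have c0 : 0 < c.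
  have : 0 < c * h a by move: hx'; rewrite x'E linearB linearZ /= subr_gt0; apply: lt_trans.
  by rewrite pmulr_lgt0.
have bxa : 0 < b x a by move: (mulr_gt0 c0 baa); rewrite cE; lra.
have d0 : 0 < d by rewrite -(pmulr_lgt0 _ bxx) dE; lra.
(* The projection of [x] orthogonal to [a] has norm [b x x (1 - c d / 4)]. Hence [c d <= 4], with
   equality only if this projection is isotropic. *)
have Q : b (x - (c / 2) *: a) (x - (c / 2) *: a) = b x x * (1 - c * d / 4).
  have -> : b x x * (1 - c * d / 4) = b x x - c * (d * b x x) / 4 by ring.
  rewrite form_subZ // dE.
  have -> : (c / 2) ^+ 2 * b a a = c / 4 * (c * b a a) by field.
  by rewrite cE; field.
have cd4 : c * d <= 4.
  by have := psd_ge0 bP (x - (c / 2) *: a); rewrite Q pmulr_rge0 //; lra.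
have noadd := min_indecomposable.
have aE : c = 1 -> a = x + x' by move=> c1; rewrite x'E c1 scale1r addrC subrK.
have [zc zcE] : exists z : int, c = z%:~R by apply/intrP/(gr_int gr).
have [zd zdE] : exists z : int, d = z%:~R by apply/intrP/(gr_int gr).
have zcd : [\/ c = 1, d = 1 /\ (c = 2 \/ c = 3) | c * d = 4].
  move: c0 d0 cd4; rewrite zcE zdE -intrM !ltr0z -[4]/(4%:~R) ler_int => c0 d0 cd4.
  have [zc1|zc1] := eqVneq zc 1; first by constructor 1; rewrite zc1.
  have [|zcd] := eqVneq (zc * zd) 4; first by move=> ->; constructor 3.
  have -> : zd = 1 by nia.
  constructor 2; split=> //.
  have [->|->] : zc = 2 \/ zc = 3 by nia.
    by left.
  by right.
case: zcd => [/aE ae|[d1 c23]|cd].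
- exact: noadd Px Px' ae.
- have Rax : Psi (a - x).
    have <- : s_ x a = a - x by rewrite reflE // -/d d1 scale1r.
    exact: (gr_refl gr).
  have Rax' : Psi (a - x').
    have <- : s_ a (x - a) = a - x'.
      rewrite linearB /= refl_id ?gt_eqF // opprK addrC.
      by rewrite /x' opprK.
    by apply: (gr_refl gr) => //; rewrite -opprB; apply: root_opp.
  have [Pax|] := pos_dichotomy Rax.
    by apply: (noadd _ _ Px Pax); rewrite addrC subrK.
  have [Pax'|] := pos_dichotomy Rax'.
    by move=> _; apply: (noadd _ _ Px' Pax'); rewrite addrC subrK.
  rewrite !opprB => Px'a Pxa.
  (* When [a - x] and [a - x'] are both negative, two positive roots add up to [(c - 2) a]: this is
     zero for [c = 2], and decomposes [a] for [c = 3]. *)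
  have e : (x - a) + (x' - a) = (c - 2) *: a.
    rewrite x'E addrACA [x + _]addrC subrK -opprD scalerBl; congr (_ - _).
    by rewrite scaler_nat mulr2n.
  case: c23 => c23.
    move: e; rewrite c23 subrr scale0r => e.
    have [[_ h1] [_ h2]] := (Pxa, Px'a).
    by have := addr_gt0 h1 h2; have := linear0 h; rewrite -e linearD => ->; rewrite ltxx.
  apply: (noadd _ _ Pxa Px'a); rewrite e c23.
  by rewrite (_ : 3 - 2 = 1) ?scale1r //; ring.
- have Q0 : b (x - (c / 2) *: a) (x - (c / 2) *: a) = 0.
    by rewrite Q cd; field.
  (* Reducedness modulo the radical forces [c / 2 = 1], so [x] and [x'] are [a] plus and minus a
     radical vector. Its sign is chosen below to make its height positive. *)
  have c2 : c = 2 by case: (gr_reduced gr Rx Ra Q0); lra.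
  move: Q0; rewrite c2 divff ?pnatr_eq0 // scale1r => Q0.
  have x'E2 : x' = a + (a - x) by rewrite x'E c2 scaler_nat mulr2n addrA.
  have hne : h x != h a by apply/eqP => /(gr_inj gr Rx Ra Q0).
  case: (ltgtP (h x) (h a)) hne => // hlt _.
    apply: (@min_no_radical (a - x)).
    + by rewrite opprB addrC subrK.
    + by rewrite -opprB (bformNl bP) (bformNr bP) opprK.
    + by rewrite linearB subr_gt0.
    + by rewrite opprB addrC subrK.
    + by rewrite -x'E2.
  have axE : a - (x - a) = x' by rewrite x'E2 opprB.
  apply: (@min_no_radical (x - a)).
  + by rewrite axE.
  + by [].
  + by rewrite linearB subr_gt0.
  + by rewrite axE.
  + by rewrite addrC subrK.
Qed.
End Minimal.

Lemma exists_simple X : closed_half Psi X -> finite_set (P `\` X) ->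
  P `\` X !=set0 -> exists2 a, simple b Psi h a & ~ X a.
Proof.
move=> chX fin /(finite_set_argmin h fin)[a Na mina].
by exists a; [exact: (min_simple chX fin Na mina) | case: Na].
Qed.

Lemma closed_half_conj X : closed_half Psi X -> finite_set (P `\` X) ->
  exists2 t, letters (simple b Psi h) t &
    forall x, Psi x -> P (word b t x) <-> X x.
Proof.
move=> + /finite_seqP[l Nl]; have: P `\` X `<=` [set` l] by rewrite Nl.
have [m] := ubnP (size l); elim: m X l {Nl} => // m IH X l lm Nl chX.
have fin : finite_set (P `\` X) by apply: sub_finite_set Nl (finite_seq l).
have [/eqP NX0|/set0P NX0] := boolP (P `\` X == set0).
  exists [::] => // x Rx; rewrite word_nil; split=> [Px|Xx].
    by apply: contrapT => nXx; have : (P `\` X) x by []; rewrite NX0.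
  apply: contrapT => /(posN Rx) PNx; have /(chN chX Rx) : X (- x).
    by apply: contrapT => nX; have : (P `\` X) (- x) by []; rewrite NX0.
  by apply.
have [a Sa nXa] := exists_simple chX fin NX0.
have [Pa aP] := Sa; have Ra := pos_root Pa; have aa0 := aniso_neq0 an Ra.
have al : a \in l by apply: Nl.
have aR : letters Psi [:: a] by move=> x; rewrite inE => /eqP->.
pose X' := [set x | X (s_ a x)].
have chX' : closed_half Psi X'.
  by rewrite /X' -(word_seq1 b); apply: closed_half_word.
(* A list covering the missing roots replaces their number. Those of [X'] are reflections of entries
   other than [a], because [- a] lies in [X] and so [a] lies in [X']. *)
have N'sub : P `\` X' `<=` [set` map (s_ a) (rem a l)].
  move=> x [Px nX'x]; have xa : x <> a.
    move=> xa; apply: nX'x; rewrite /X' /= xa refl_id //.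
    by apply/(chN chX).
  rewrite /= -[x](reflK bP aa0); apply: map_f; apply: rem_mem.
    apply/eqP => e; have xE : x = - a by rewrite -[LHS](reflK bP aa0) e refl_id.
    by move: Px; rewrite xE => /(posN Ra).
  by apply: Nl; split=> //; apply: aP.
have sl : (size (map (s_ a) (rem a l)) < m)%N.
  by rewrite size_map size_rem //; case: (l) al lm.
have [t St tX] := IH X' _ sl N'sub chX'.
exists (rcons t a) => [x|x Rx].
  by rewrite mem_rcons inE => /predU1P[->//|/St].
rewrite -cats1 word_catE word_seq1 tX; last exact: (gr_refl gr).
by rewrite /X' /= reflK.
Qed.

(** * Generation by simple reflections *)

Section Generators.
Variable S : set U.
Hypothesis simS : S `<=` simple b Psi h.
Hypothesis acute : forall x, P x -> ~ S x -> exists2 a, S a & 0 < b x a.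

(** Reflecting [x] in an acute simple root [a] subtracts a positive integral multiple of [a], so the
    height drops, and [s_x] is the conjugate by [s_a] of the reflection in the lower root. *)
Lemma pos_refl_in_simple_group x : P x ->
  exists2 t, letters S t & s_ x = word b t.
Proof.
have letters1 a : S a -> letters S [:: a] by move=> Sa y; rewrite inE => /eqP->.
move=> Px; have [m] := ubnP (Num.truncn (h x)); elim: m x Px => // m IH x Px hm.
have [Sx|nSx] := pselect (S x).
  by exists [:: x]; [exact: letters1 | rewrite word_seq1].
have [a Sa xa] := acute Px nSx; have Sima := simS Sa.
have [Pa aP] := Sima; have [Ra ha] := Pa; have baa := an Ra.
have [Rx hx] := Px; have bxx := an Rx; have a0 := aniso_neq0 an Ra.
have Pax : P (s_ a x) by apply: aP => // e; apply: nSx; rewrite e.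
have c1 : 1 <= 2 * b x a / b a a.
  by apply: int_ge1; [exact: (gr_int gr) | rewrite divr_gt0 ?mulr_gt0].
have hlt : (Num.truncn (h (s_ a x)) < Num.truncn (h x))%N.
  have [Rax hax] := Pax.
  rewrite -(@ltr_nat R) !truncnK ?natrEint ?(gr_height_int gr) ?ltW //.
  rewrite reflE // linearB linearZ /= gtrDl oppr_lt0.
  by rewrite mulr_gt0 // (lt_le_trans ltr01).
have [t St tE] := IH _ Pax (leq_trans hlt hm).
have LSima : letters Psi [:: a] by move=> y; rewrite inE => /eqP->.
exists (a :: t ++ [:: a]).
  by apply/letters_cons; split=> //; apply/letters_cat; split=> //; apply: letters1.
apply/lfunP => y; rewrite word_cons word_catE word_seq1 -tE.
have := refl_conj bP an (s_ a x) (s_ a y) LSima.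
by rewrite word_seq1 !reflK.
Qed.

Lemma refl_in_simple_group x : Psi x -> exists2 t, letters S t & s_ x = word b t.
Proof.
move=> Rx; have [|] := pos_dichotomy Rx => /pos_refl_in_simple_group//.
by rewrite reflN.
Qed.

Lemma letters_in_simple_group t : letters Psi t ->
  exists2 s, letters S s & word b t = word b s.
Proof.
elim: t => [_|a t IH]; first by exists [::].
move=> /letters_cons[/refl_in_simple_group[s1 Ss1 e1] /IH[s2 Ss2 e2]].
exists (s1 ++ s2); first by apply/letters_cat.
by rewrite word_cat /= e1 e2.
Qed.

End Generators.

(** * Deletion and the triviality of elements preserving positivity *)

Hypothesis fin_refl : forall x, Psi x -> finite_set (P `\` [set y | P (s_ x y)]).

(** The half made positive by [s_x] misses [x], hence it misses a simple root [a]. A negative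
    [s_x a] means that a positive multiple of [x] was subtracted from [a]. *)
Lemma acute_simple x : P x -> ~ simple b Psi h x ->
  exists2 a, simple b Psi h a & 0 < b x a.
Proof.
move=> Px nSx; have Rx := pos_root Px; have x0 := aniso_neq0 an Rx.
have ch : closed_half Psi [set y | P (s_ x y)].
  rewrite -(word_seq1 b); apply: closed_half_word; last exact: pos_closed_half.
  by move=> y; rewrite inE => /eqP->.
have [] := exists_simple ch (fin_refl Rx).
  by exists x; split=> //=; rewrite refl_id // => /(posN Rx).
move=> a Sa nP; exists a => //.
have [[Ra ha] aP] := Sa.
rewrite ltNge; apply/negP => xa; apply: nP; split; first exact: (gr_refl gr).
rewrite reflE // linearB linearZ /= subr_gt0.
apply: le_lt_trans ha; rewrite mulr_le0_ge0 //; last by case: Px => _ /ltW.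
rewrite mulr_le0_ge0 ?invr_ge0 ?(psd_ge0 bP) //.
by rewrite mulr_ge0_le0 // (psdC bP).
Qed.

(** Read from the right, some letter turns a positive image negative; a simple reflection does this
    only to its own root. *)
Lemma word_neg_split t x : letters (simple b Psi h) t -> P x -> ~ P (word b t x) ->
  exists t1 a t2, t = t1 ++ a :: t2 /\ word b t2 x = a.
Proof.
elim: t => [_ Px|a t IH]; first by rewrite word_nil.
move=> /letters_cons[Sa St] Px; rewrite word_cons => nP.
have [Ptx|nPtx] := pselect (P (word b t x)).
  by exists [::], a, t; split=> //; apply: simple_neg nP.
have [t1 [c [t2 [-> e]]]] := IH St Px nPtx.
by exists (a :: t1), c, t2.
Qed.

(* Deletion: if [w a > 0] for the last letter [a] of [w], the word of [w] can be
   shortened by two letters. *)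
Lemma pos_stable_simple_word t : letters (simple b Psi h) t ->
  (forall x, P x -> P (word b t x)) -> word b t = \1%VF.
Proof.
have [m] := ubnP (size t); elim: m t => // m IH t.
case/lastP: t => // t a tm Sta Pst.
move: Sta Pst; rewrite -cats1 => /letters_cat[St /(_ a (mem_head _ _)) Sa] Pst.
have Ra := simple_root Sa; have [Pa _] := Sa; have a0 := aniso_neq0 an Ra.
have Lt (l : seq U) : letters (simple b Psi h) l -> letters Psi l.
  by apply: letters_sub => x /simple_root.
have nP : ~ P (word b t a).
  have := Pst _ Pa; rewrite word_catE word_seq1 refl_id // linearN.
  by move/(posN (word_root (Lt _ St) Ra)).
have [t1 [c [t2 [te ce]]]] := word_neg_split St Pa nP.
have St2 : letters (simple b Psi h) (t1 ++ t2).
  by move: St; rewrite te => /letters_cat[S1 /letters_cons[_ S2]]; apply/letters_cat.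
have S2 : letters (simple b Psi h) t2 by move: St2 => /letters_cat[].
(* Since [c] is the image of [a] under [t2], conjugation gives [s_c t2 s_a = t2], and the letters
   [c] and [a] cancel. *)
have e : word b (t ++ [:: a]) = word b (t1 ++ t2).
  apply/lfunP => x; rewrite te -catA cat_cons !word_catE word_cons word_catE word_seq1.
  by rewrite -ce -(refl_conj bP an) ?reflK //; apply: Lt.
rewrite e; apply: IH => //; last by rewrite -e.
move: tm; rewrite te size_rcons !size_cat /=; lia.
Qed.

Lemma pos_stable_word t : letters Psi t ->
  (forall x, P x -> P (word b t x)) -> word b t = \1%VF.
Proof.
move=> /(letters_in_simple_group (fun x => id) acute_simple)[s Ss ->].
exact: pos_stable_simple_word.
Qed.

End Theory.
End Roots.

(** A hyperplane section inherits the height, so the theory applies to [Phi_F] without knowing its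
    components or simple roots. *)
Lemma graded_roots_sub (R : realType) (U : vectType R) (b : U -> U -> R)
    (Psi : set U) (h g : 'Hom(U, R^o)) :
  graded_roots b Psi h -> graded_roots b [set x | Psi x /\ g x = 0] h.
Proof.
move=> [bP an re int red inj hint h0]; split=> //.
- by move=> x [/an].
- move=> a x [Ra ga] [Rx gx]; split; first exact: re.
  by rewrite reflE // linearB linearZ /= ga gx scaler0 subr0.
- by move=> a x [Ra _] [Rx _]; apply: int.
- by move=> x y c [Rx _] [Ry _]; apply: red.
- by move=> x y [Rx _] [Ry _]; apply: inj.
- by move=> x [/hint].
- by move=> x [/h0].
Qed.

(** * The affine root system and its height *)

Section Affine.
Context {R : realType} {V0 : vectType R} (form : {dot V0 for idfun}).
Variables (Phi0 : set V0) (n : nat) (Delta : n.-tuple V0) (theta : V0).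
Hypotheses (rsP : root_system form Phi0) (srP : simple_roots Phi0 Delta)
  (hrP : highest_root Phi0 Delta theta).
Local Notation V := (V0 * R^o)%type.
Local Notation aff := (aform form).
Implicit Types (a c : V0) (x y z : V) (s t : seq V).

Lemma dot_psd : psd_form form.
Proof.
split=> [x y z|c x y|x y|x].
- exact: linearDl.
- exact: linearZl.
- by rewrite hermC /= mul1r.
- by have [->|x0] := eqVneq x 0; rewrite ?linear0l // ltW // neq0_dnorm_gt0.
Qed.

Lemma form_gt0 a : a != 0 -> 0 < form a a.
Proof. exact: neq0_dnorm_gt0. Qed.

Lemma form_eq0 a : form a a = 0 -> a = 0.
Proof. by move=> a0; apply/eqP/negPn/negP => /form_gt0; rewrite a0 ltxx. Qed.

Lemma aform_psd : psd_form aff.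
Proof.
have dP := dot_psd; rewrite /aform; split=> [x y z|k x y|x y|x] /=.
- exact: (psdD dP).
- exact: (psdZ dP).
- exact: (psdC dP).
- exact: (psd_ge0 dP).
Qed.

Lemma root_neq0 a : Phi0 a -> a != 0.
Proof. by move=> Pa; apply/eqP => a0; apply: (rs_neq0 rsP); rewrite -a0. Qed.

(** The height stays arbitrary because faces require heights adapted to chambers other than the
    dominant one. *)
Lemma graded_finite_roots (h : 'Hom(V0, R^o)) :
  (forall a, Phi0 a -> h a \is a Num.int) -> (forall a, Phi0 a -> h a != 0) ->
  graded_roots form Phi0 h.
Proof.
move=> hint h0; split=> //.
- exact: dot_psd.
- by move=> a /root_neq0/form_gt0.
- by move=> a x; apply: rs_refl.
- by move=> a x; apply: rs_crystallographic.
- move=> x y c Px Py /form_eq0/eqP; rewrite subr_eq0 => /eqP xE.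
  by apply: (rs_reduced rsP Py); rewrite -xE.
- by move=> x y _ _ /form_eq0/eqP; rewrite subr_eq0 => /eqP.
Qed.

Definition level x : R := x.2.

Definition height : 'Hom(V0, R^o) := linfun (fun a => \sum_i coord Delta i a : R^o).

Lemma heightE a : height a = \sum_i coord Delta i a.
Proof.
rewrite linfun_linE // => k u v; rewrite scaler_sumr -big_split /=.
by apply: eq_bigr => i _; rewrite linearP.
Qed.

Lemma coord_eq0 a : (forall i, coord Delta i a = 0) -> a = 0.
Proof.
move=> a0; rewrite (coord_basis (sr_basis srP) (memvf a)).
by apply: big1 => i _; rewrite a0 scale0r.
Qed.

Lemma coord_inj a c : (forall i, coord Delta i a = coord Delta i c) -> a = c.
Proof.
move=> e; apply/eqP; rewrite -subr_eq0; apply/eqP/coord_eq0 => i.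
by rewrite linearB /= e subrr.
Qed.

Lemma finite_rootN a : Phi0 a -> Phi0 (- a).
Proof.
move=> Pa; rewrite -(refl_id dot_psd (a := a)); first exact: (rs_refl rsP).
by rewrite gt_eqF // form_gt0 // root_neq0.
Qed.

Lemma height_gt0 a : Phi0 a -> (forall i, 0 <= coord Delta i a) -> 0 < height a.
Proof.
move=> /root_neq0 a0 ca; rewrite heightE lt_def sumr_ge0 ?andbT //.
apply: contra_neq a0 => s0; apply: coord_eq0 => i.
by apply: (psumr_eq0P _ s0).
Qed.

Lemma pos_roots0E a : pos_roots0 Phi0 Delta a <-> Phi0 a /\ 0 < height a.
Proof.
split=> [[Pa ca]|[Pa ha]]; first by split=> //; apply: height_gt0.
split=> // i; have [/(_ i)|cNa] := sr_sign srP Pa; first by move/natr_ge0.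
have : 0 < height (- a).
  by apply: height_gt0 => [|j]; [exact: finite_rootN | apply: natr_ge0].
by rewrite linearN /= oppr_gt0 => /(lt_trans ha); rewrite ltxx.
Qed.

Lemma coord_root_int a i : Phi0 a -> coord Delta i a \is a Num.int.
Proof.
by move=> /(sr_sign srP)[] /(_ i)/intr_nat//; rewrite linearN /= rpredN.
Qed.

Lemma height_int a : Phi0 a -> height a \is a Num.int.
Proof. by move=> Pa; rewrite heightE rpred_sum // => i _; apply: coord_root_int. Qed.

Lemma height_neq0 a : Phi0 a -> height a != 0.
Proof.
move=> Pa; have [/(_ _)ca|ca] := sr_sign srP Pa.
  by rewrite gt_eqF // height_gt0 // => i; apply: natr_ge0.
rewrite -oppr_eq0 -linearN gt_eqF //; apply: height_gt0 => [|i].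
  exact: finite_rootN.
exact: natr_ge0.
Qed.

(** Delta receives the height of [theta] plus one, so that [delta - theta] has height 1 like the
    finite simple roots, and every root of level at least 1 becomes positive. *)
Definition aff_height : 'Hom(V, R^o) :=
  linfun (fun x : V => height x.1 + x.2 * (height theta + 1) : R^o).

Lemma aff_heightE x : aff_height x = height x.1 + level x * (height theta + 1).
Proof.
rewrite linfun_linE // => k u v /=.
rewrite linearP /= scalerDr addrACA; congr (_ + _).
by rewrite mulrDl -mulrA.
Qed.

Lemma height_theta a : Phi0 a -> height a <= height theta.
Proof.
by move=> Pa; rewrite !heightE; apply: ler_sum => i _; apply: hrP.2.
Qed.

Lemma height_theta_ge1 : 1 <= height theta.
Proof.
have Pt := hrP.1; apply: int_ge1; first exact: height_int.
have := height_theta (finite_rootN Pt); rewrite linearN /= => h1.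
rewrite lt_def height_neq0 //=; move: h1; set u := height theta.
by rewrite -subr_ge0 opprK -mulr2n pmulrn_lge0.
Qed.

Lemma aff_rootE a k : aff_root a k = (a, k%:~R) :> V.
Proof.
by rewrite /aff_root /delta; congr pair => /=; rewrite ?scaler0 ?addr0 // add0r [LHS]mulr1.
Qed.

Lemma level_refl x y : level (refl aff y x) =
  level x - 2 * form x.1 y.1 / form y.1 y.1 * level y.
Proof. by rewrite reflE; last exact: aform_psd. Qed.

Lemma refl_fst x y : (refl aff y x).1 = refl form y.1 x.1.
Proof. by rewrite !reflE; [| exact: dot_psd | exact: aform_psd]. Qed.

Lemma roots_aff_root a k : Phi0 a -> Defs.roots Phi0 (aff_root a k).
Proof. by move=> Pa; exists a => //; exists k. Qed.

Lemma rootsP x : Defs.roots Phi0 x <-> Phi0 x.1 /\ level x \is a Num.int.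
Proof.
split=> [[a Pa [k _ <-]]|]; first by rewrite aff_rootE /= intr_int.
by case: x => a k /= [Pa /intrP[m ->]]; exists a => //; exists m; rewrite ?aff_rootE.
Qed.

Lemma aff_height_gt0 x : Phi0 x.1 -> 1 <= level x -> 0 < aff_height x.
Proof.
move=> Px x1; rewrite aff_heightE; have ht1 := height_theta_ge1.
have := height_theta (finite_rootN Px); rewrite linearN /= => hx.
have : height theta + 1 <= level x * (height theta + 1).
  by rewrite ler_peMl //; apply: addr_ge0 => //; apply: le_trans ht1.
have arith (u v t : R) : - u <= t -> t + 1 <= v -> 0 < u + v by lra.
exact: arith hx.
Qed.

Lemma graded_aff_roots : graded_roots aff (Defs.roots Phi0) aff_height.
Proof.
have g0 := graded_finite_roots height_int height_neq0.
have ht1 := height_theta_ge1.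
split.
- exact: aform_psd.
- by move=> x /rootsP[/root_neq0/form_gt0].
- move=> x y /rootsP[Px ix] /rootsP[Py iy]; apply/rootsP.
  rewrite refl_fst level_refl; split; first exact: (rs_refl rsP).
  by apply: rpredB => //; apply: rpredM => //; apply: (rs_crystallographic rsP).
- by move=> x y /rootsP[Px _] /rootsP[Py _]; apply: (rs_crystallographic rsP).
- by move=> x y c /rootsP[Px _] /rootsP[Py _]; apply: (gr_reduced g0).
- move=> [a k] [c l] _ _ /form_eq0/eqP /=; rewrite subr_eq0 => /eqP->.
  rewrite !aff_heightE /= => /addrI/mulIf -> //.
  by rewrite gt_eqF //; lra.
- move=> x /rootsP[Px ix]; rewrite aff_heightE.
  apply: rpredD; first exact: height_int.
  apply: rpredM => //; apply: rpredD; last exact: rpred1.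
  exact: height_int hrP.1.
- move=> [a k] /rootsP[/= Pa /intrP[m ->]].
  have [m0|m0|->] := ltgtP m 0; last by rewrite aff_heightE /level mul0r addr0 height_neq0.
    rewrite -oppr_eq0 -linearN /= gt_eqF //; apply: aff_height_gt0; first exact: finite_rootN.
    by rewrite /level /= -mulrNz ler1z; lia.
  by rewrite gt_eqF //; apply: aff_height_gt0; rewrite // /level ler1z; lia.
Qed.

Local Notation Phi := (Defs.roots Phi0).
Local Notation P := (pos Phi aff_height).

Lemma pos_rootsE : pos_roots Phi0 Delta = P.
Proof.
apply/seteqP; split=> x.
  case=> [[a /pos_roots0E[Pa ha] <-]|[a Pa [k k1 <-]]]; split; try exact: roots_aff_root.
    by rewrite aff_rootE aff_heightE /level /= mul0r addr0.
  by apply: aff_height_gt0; rewrite /level aff_rootE //= ler1z.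
case=> -[a Pa [k _ <-]] ha; have [k1|k1|k0] := ltgtP k 0.
- have : 0 < aff_height (- aff_root a k).
    apply: aff_height_gt0; rewrite /level aff_rootE /=; first exact: finite_rootN.
    by rewrite -mulrNz ler1z; lia.
  by rewrite linearN /= oppr_gt0 => /(lt_trans ha); rewrite ltxx.
- by right; exists a => //; exists k.
- left; exists a; rewrite ?k0 //; apply/pos_roots0E; split=> //.
  by move: ha; rewrite k0 aff_rootE aff_heightE /level /= mul0r addr0.
Qed.


Lemma pos_level x : P x -> 0 <= level x.
Proof.
rewrite -pos_rootsE => -[[a _ <-]|[a _ [k /= k1 <-]]]; rewrite /level aff_rootE //=.
by rewrite ler0z; lia.
Qed.

Lemma pos_coord x : Phi x -> (forall i, 0 <= coord Delta i x.1) -> 0 <= level x -> P x.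
Proof.
move=> Rx cx lx; have [Px _] := (rootsP x).1 Rx; split=> //.
rewrite aff_heightE ltr_pwDl ?height_gt0 // mulr_ge0 //.
by apply: addr_ge0 => //; apply: le_trans height_theta_ge1.
Qed.

Lemma word_fst t x : (word aff t x).1 = word form (map fst t) x.1.
Proof.
elim: t => [|a t IH]; first by rewrite !word_nil.
by rewrite word_cons refl_fst IH -word_cons.
Qed.

Lemma word_level t x : level (word aff t x) = level x + level (word aff t (x.1, 0)).
Proof.
elim: t => [|a t IH]; first by rewrite !word_nil {3}/level /= addr0.
by rewrite !word_cons !level_refl IH addrA !word_fst.
Qed.

Lemma letters_fst t : letters Phi t -> letters Phi0 (map fst t).
Proof. by move=> Rt x /mapP[y /Rt/rootsP[Py _] ->]. Qed.

(** A word shifts the level by an amount depending only on the finite part. Positive roots have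
    level at least 0 and negative ones at most 0, so an inversion has bounded level over each of the
    finitely many finite parts. *)
Lemma finite_inversions t : letters Phi t ->
  finite_set (P `\` [set x | P (word aff t x)]).
Proof.
move=> Rt; pose m a := level (word aff t (a, 0)).
apply: (@sub_finite_set _ _
  (\bigcup_(a in Phi0) [set aff_root a (Posz k) | k in `I_(Num.truncn (- m a)).+1])).
  move=> x [Px nPtx]; have [Rx lx] := (rootsP x).1 (pos_root Px).
  have Rtx := word_root graded_aff_roots Rt (pos_root Px).
  have := pos_level ((posN graded_aff_roots Rtx).2 nPtx).
  rewrite {1}/level /= oppr_ge0 -/(level _) word_level -/(m _) -lerBrDl sub0r => lxm.
  have lx0 := pos_level Px.
  have /natrP[k kE] : level x \is a Num.nat by rewrite natrEint lx.
  exists x.1 => //; exists k => /=.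
    have {}lxm : level x <= - m x.1 by rewrite lerNr.
    by rewrite ltnS truncn_ge_nat -?kE // (le_trans lx0 lxm).
  by rewrite aff_rootE [RHS]surjective_pairing; congr pair; rewrite -[RHS]/(level x) kE.
apply: bigcup_finite => [|a _]; first exact: rs_finite rsP.
exact/finite_image/finite_II.
Qed.

(** * The simple affine roots and the generation of the affine Weyl group *)

Definition aff_simple : set V :=
  [set aff_root (tnth Delta i) 0 | i in [set: 'I_n]] `|` [set aff_root (- theta) 1].

Lemma coord_tnth i j : coord Delta i (tnth Delta j) = (i == j)%:R.
Proof.
by rewrite (tnth_nth 0) coord_free ?(basis_free (sr_basis srP)) ?(eq_sym i).
Qed.

Lemma coord_addtheta a i : Phi0 a -> 0 <= coord Delta i (a + theta).
Proof.
move=> Pa; have := hrP.2 _ i (finite_rootN Pa).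
by rewrite linearN linearD /= -subr_ge0 opprK addrC.
Qed.

Lemma coord_theta_ge0 i : 0 <= coord Delta i theta.
Proof.
by have := coord_addtheta i hrP.1; rewrite linearD /= -mulr2n pmulrn_lge0.
Qed.

(** Only the coordinate at [i] changes. If the image is negative, all other coordinates of [a]
    vanish, and reducedness makes [a] the simple root. *)
Lemma refl_simple_pos i a : pos_roots0 Phi0 Delta a -> a <> tnth Delta i ->
  pos_roots0 Phi0 Delta (refl form (tnth Delta i) a).
Proof.
move=> [Pa ca] ai; set y := refl form _ a.
have Pi := sr_root srP i; have Py : Phi0 y by exact: (rs_refl rsP).
have cy j : j != i -> coord Delta j y = coord Delta j a.
  move=> ji; rewrite /y reflE; last exact: dot_psd.
  by rewrite linearB linearZ /= coord_tnth (negbTE ji) mulr0 subr0.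
have [yp|yn] := sr_sign srP Py; first by split=> // j; apply: natr_ge0.
case: ai; have aE : a = coord Delta i a *: tnth Delta i.
  apply: coord_inj => j; rewrite linearZ /= coord_tnth.
  have [->|ji] := eqVneq j i; rewrite ?mulr1 // mulr0.
  apply/eqP; rewrite eq_le ca andbT -cy //.
  by have /natr_ge0 := yn j; rewrite linearN /= oppr_ge0.
have : Phi0 (coord Delta i a *: tnth Delta i) by rewrite -aE.
move=> /(rs_reduced rsP Pi)[c1|c1]; first by rewrite aE c1 scale1r.
by have := ca i; rewrite c1 ler0N1.
Qed.

(** A finite simple reflection preserves levels, so only level 0 is at stake. For [delta - theta]
    the reflection adds the Cartan integer [c] of [x.1] and [theta] to the level, and negative [c]
    is the delicate case. *)
Lemma aff_simple_simple : aff_simple `<=` simple aff Phi aff_height.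
Proof.
have gr := graded_aff_roots.
move=> _ [[i _ <-]|->].
  have Pi := sr_root srP i.
  have Ri : Phi (aff_root (tnth Delta i) 0) by exact: roots_aff_root.
  split=> [|x Px xi].
    apply: pos_coord => // [j|]; last by rewrite /level aff_rootE.
    by rewrite aff_rootE coord_tnth ler0n.
  have [Rx lx] := (rootsP x).1 (pos_root Px); have lx0 := pos_level Px.
  have Ry := gr_refl gr Ri (pos_root Px).
  set y := refl _ _ x in Ry *.
  have ly : level y = level x.
    by rewrite level_refl aff_rootE {2}/level /= mulr0 subr0.
  have [l0|l0] := eqVneq (level x) 0; last first.
    split=> //; apply: aff_height_gt0; first by have [] := (rootsP y).1 Ry.
    by rewrite ly int_ge1 // lt_def l0.
  have xE : x = aff_root x.1 0.
    by rewrite aff_rootE [LHS]surjective_pairing; congr pair; rewrite -[LHS]/(level x) l0.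
  have px : pos_roots0 Phi0 Delta x.1.
    by apply/pos_roots0E; split=> //; case: Px => _; rewrite aff_heightE l0 mul0r addr0.
  have xi' : x.1 <> tnth Delta i by move=> e; apply: xi; rewrite xE e.
  have [_ cy] := refl_simple_pos px xi'.
  by apply: pos_coord; rewrite ?ly //; move=> j; rewrite refl_fst aff_rootE.
have Pt := hrP.1; have Pnt := finite_rootN Pt.
have R0 : Phi (aff_root (- theta) 1) by exact: roots_aff_root.
split=> [|x Px x0].
  by split=> //; apply: aff_height_gt0; rewrite /level aff_rootE.
have [Rx lx] := (rootsP x).1 (pos_root Px); have lx0 := pos_level Px.
have Ry := gr_refl gr R0 (pos_root Px).
set y := refl _ _ x in Ry *; have [Py ly] := (rootsP y).1 Ry.
have [c cE] : exists c : int, 2 * form x.1 theta / form theta theta = c%:~R.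
  by apply/intrP/(rs_crystallographic rsP).
have y1E : y.1 = x.1 - c%:~R *: theta.
  rewrite refl_fst aff_rootE /= reflN ?(reflE dot_psd) ?cE //.
  exact: dot_psd.
have lyE : level y = level x + c%:~R.
  rewrite level_refl aff_rootE {2}/level /= mulr1.
  rewrite !(bformE dot_psd) opprK -cE mulrN mulNr opprK //.
have [c0|c0|c0] := ltgtP c 0; last first.
- suff -> : y = x by [].
  rewrite [y]surjective_pairing [RHS]surjective_pairing y1E c0 scale0r subr0.
  by congr pair; rewrite -[LHS]/(level y) lyE c0 addr0.
- split=> //; apply: aff_height_gt0 => //; rewrite lyE.
  by rewrite (@le_trans _ _ c%:~R) // ?lerDr // ler1z; lia.
(* The reflected finite part [x.1 - c theta] is bounded by [theta]. For [c < 0] this makes [x.1]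
   nonpositive, so a positive [x] has level at least 1. *)
have cx i : coord Delta i x.1 <= (1 + c%:~R) * coord Delta i theta.
  have := hrP.2 _ i Py; rewrite y1E linearB linearZ /= lerBlDr.
  by rewrite mulrDl mul1r.
have [k kE] := intrP lx.
have k0 : 1 <= k.
  have : level x != 0.
    apply/eqP => l0; case: Px => _; rewrite aff_heightE l0 mul0r addr0.
    apply/negP; rewrite -leNgt heightE sumr_le0 // => i _.
    apply: le_trans (cx i) _; rewrite mulr_le0_ge0 ?coord_theta_ge0 //.
    by rewrite -(intrD _ 1) lerz0; lia.
  by move: lx0; rewrite kE ler0z intr_eq0; lia.
have [c1|c1] := eqVneq c (-1).
  apply: pos_coord => //; last by rewrite lyE kE c1 -intrD ler0z; lia.
  by move=> i; rewrite y1E c1 scaleN1r opprK; apply: coord_addtheta.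
(* For [c <= -2] the bound squeezes [x.1] down to [- theta], whence [c = -2]; level 1 would be
   [delta - theta] itself, so the level is at least 2. *)
have x1E : x.1 = - theta.
  apply: coord_inj => i; apply/eqP; rewrite eq_le linearN /=; apply/andP; split.
    apply: le_trans (cx i) _; rewrite -mulN1r ler_wpM2r ?coord_theta_ge0 //.
    by rewrite -(intrD _ 1) -[-1]/((-1)%:~R) ler_int; lia.
  by have := coord_addtheta i Rx; rewrite linearD /= -lerBlDr sub0r.
have c2 : c = -2.
  apply: (@intr_inj R); rewrite -cE x1E (bformNl dot_psd) mulrN mulNr mulfK //.
  by rewrite gt_eqF // form_gt0 // root_neq0.
have k2 : k != 1.
  apply/eqP => k1; apply: x0; rewrite aff_rootE -x1E [LHS]surjective_pairing.
  by congr pair; rewrite -[LHS]/(level x) kE k1.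
apply: pos_coord => //; last by rewrite lyE kE c2 -intrD ler0z; lia.
move=> i; rewrite y1E x1E c2 linearB linearN linearZ /=.
have e (u : R) : - u - (- 2)%:~R * u = u by rewrite mulrNz; ring.
by rewrite e coord_theta_ge0.
Qed.

(** Otherwise [x.1] is obtuse to all simple roots and has nonnegative product with [theta]. As
    [x.1 + theta] has nonnegative coordinates, [form x.1 x.1] would be at most 0. *)
Lemma aff_acute x : Phi x -> exists2 a, aff_simple a & 0 < aff x a.
Proof.
move=> /rootsP[Px _]; apply: contrapT => no.
have le0 (a : V) : aff_simple a -> aff x a <= 0.
  by move=> Sa; rewrite leNgt; apply/negP => xa; apply: no; exists a.
have xi i : form x.1 (tnth Delta i) <= 0.
  have := le0 (aff_root (tnth Delta i) 0) (or_introl _ (ex_intro2 _ _ i I erefl)).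
  by rewrite /aform aff_rootE.
have xt : - form x.1 theta <= 0.
  by have := le0 _ (or_intror _ erefl); rewrite /aform aff_rootE /= (bformNr dot_psd).
have := form_gt0 (root_neq0 Px); apply/negP; rewrite -leNgt.
have -> : form x.1 x.1 = form x.1 (x.1 + theta) - form x.1 theta.
  by rewrite (bformDr dot_psd) addrK.
apply: (@le_trans _ _ (form x.1 (x.1 + theta))); first by rewrite gerDl.
have -> : form x.1 (x.1 + theta) = \sum_i coord Delta i (x.1 + theta) * form x.1 Delta`_i.
  rewrite {1}(coord_basis (sr_basis srP) (memvf (x.1 + theta))) linear_sum.
  by apply: eq_bigr => i _; rewrite linearZ.
rewrite sumr_le0 // => i _.
by rewrite mulr_ge0_le0 ?coord_addtheta // -tnth_nth.
Qed.

Lemma roots_weyl t : letters Phi t -> weyl form Delta theta (word aff t).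
Proof.
have acute x : P x -> ~ aff_simple x -> exists2 a, aff_simple a & 0 < aff x a.
  by move=> /pos_root/aff_acute.
move=> Rt.
have [s Ss ->] := letters_in_simple_group graded_aff_roots aff_simple_simple acute Rt.
exact: generated_word.
Qed.

Lemma weyl_letters w : weyl form Delta theta w -> exists2 t, letters Phi t & w = word aff t.
Proof.
have S : aff_simple `<=` Phi by move=> x /aff_simple_simple/simple_root.
have an : anisotropic aff aff_simple by move=> x /S/(gr_aniso graded_aff_roots).
by move=> /(refl_groupP aform_psd an)[t /(letters_sub S) Rt ->]; exists t.
Qed.

(** * Half hats, biclosed sets and the action *)

Definition hat (B : set V) : set V :=
  [set x | Phi x /\ ((P x /\ B x) \/ (P (- x) /\ ~ B (- x)))].

Implicit Type B : set V.

Lemma hat_pos B x : P x -> hat B x <-> B x.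
Proof.
move=> Px; have Rx := pos_root Px.
split=> [[_ [[]//|[/(posN graded_aff_roots Rx)//]]]|Bx].
by split=> //; left.
Qed.

Lemma hat_neg B x : P (- x) -> hat B x <-> ~ B (- x).
Proof.
move=> Px; have Rx : Phi x by apply/(root_oppE graded_aff_roots); exact: pos_root Px.
split=> [[_ [[Px' _]|[]//]]|nB]; last by split=> //; right.
by have /(posN graded_aff_roots Rx) := Px.
Qed.

Lemma hatN B x : Phi x -> hat B (- x) <-> ~ hat B x.
Proof.
move=> Rx; have [Px|Px] := pos_dichotomy graded_aff_roots Rx.
  have := @hat_neg B (- x); rewrite opprK => /(_ Px) e1.
  have e2 := hat_pos B Px; tauto.
have e1 := hat_pos B Px; have e2 := hat_neg B Px.
split=> [/e1 hN hx|nB]; first exact: e2.1 hx hN.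
by apply/e1; apply: contrapT => nBN; apply: nB; apply/e2.
Qed.

(* For roots of mixed sign, [z = k x - l y] rewrites as a positive combination
   among [x], [y] and [z] with all terms positive roots. *)
Lemma biclosed_hat B : B `<=` P -> biclosed Phi0 Delta B <-> closed_half Phi (hat B).
Proof.
have gr := graded_aff_roots => BP; rewrite /biclosed pos_rootsE.
split=> [[_ bc]|ch]; last first.
  split=> // x y z Px Py Pz [k [l [k0 l0 ze]]].
  have [[Rx Ry] Rz] := (pos_root Px, pos_root Py, pos_root Pz).
  split=> [/(hat_pos B Px) Bx /(hat_pos B Py) By|].
    by apply/(hat_pos B Pz)/(ch_closed ch Rx Ry Rz Bx By k0 l0 ze).
  move=> nBx nBy Bz; have [hx hy] := (hatN B Rx, hatN B Ry).
  have Bx : hat B (- x) by apply/hx => /(hat_pos B Px).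
  have By : hat B (- y) by apply/hy => /(hat_pos B Py).
  suff /(hatN B Rz) : hat B (- z) by apply; apply/hat_pos.
  have := (ch_closed ch (root_opp gr Rx) (root_opp gr Ry) (root_opp gr Rz) Bx By k0 l0); apply.
  by rewrite ze opprD !scalerN.
split=> [x Rx|]; first exact: hatN.
have mixed x y z k l : Phi x -> P y -> Phi z -> 0 < k -> 0 < l ->
    P x -> B x -> ~ B y -> z = k *: x - l *: y -> hat B z.
  move=> Rx Py Rz k0 l0 Px Bx nBy ze.
  have [Pz|Pz] := pos_dichotomy gr Rz.
    apply/(hat_pos B Pz); apply: contrapT => nBz.
    have [_ /(_ nBz nBy)] : (B z -> B y -> B x) /\ (~ B z -> ~ B y -> ~ B x); last by [].
    apply: bc => //; exists k^-1, (k^-1 * l); rewrite ?mulr_gt0 ?invr_gt0 //; split=> //.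
    by rewrite ze scalerBr !scalerA mulVf ?gt_eqF // scale1r subrK.
  apply/(hat_neg B Pz) => Bz; apply: nBy.
  have [/(_ Bz Bx)] : (B (- z) -> B x -> B y) /\ (~ B (- z) -> ~ B x -> ~ B y); last by [].
  apply: bc => //; exists l^-1, (l^-1 * k); rewrite ?mulr_gt0 ?invr_gt0 //; split=> //.
  by rewrite ze opprB scalerBr !scalerA mulVf ?gt_eqF // scale1r subrK.
move=> x y z k l Rx Ry Rz Bx By k0 l0 ze.
have [Px|Px] := pos_dichotomy gr Rx; have [Py|Py] := pos_dichotomy gr Ry.
- have Pz : P z.
    split=> //; rewrite ze linearD !linearZ /=.
    by case: Px Py => _ hx [_ hy]; rewrite addr_gt0 // mulr_gt0.
  move: Bx By => /(hat_pos B Px) Bx /(hat_pos B Py) By; apply/hat_pos => //.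
  by have [/(_ Bx By)] := bc x y z Px Py Pz (ex_intro _ k (ex_intro _ l (And3 k0 l0 ze))).
- move: Bx By => /(hat_pos B Px) Bx /(hat_neg B Py) By.
  by apply: mixed k0 l0 Px Bx By _; rewrite // ze scalerN opprK.
- move: Bx By => /(hat_neg B Px) Bx /(hat_pos B Py) By.
  by apply: mixed l0 k0 Py By Bx _; rewrite // ze scalerN opprK addrC.
- have zeN : - z = k *: - x + l *: - y by rewrite ze opprD !scalerN.
  have Pz : P (- z).
    split; first exact: (root_opp gr Rz).
    rewrite zeN linearD !linearZ /=.
    by case: Px Py => _ hx [_ hy]; rewrite addr_gt0 // mulr_gt0.
  move: Bx By => /(hat_neg B Px) Bx /(hat_neg B Py) By; apply/hat_neg => //.
  by have [_ /(_ Bx By)] := bc _ _ _ Px Py Pz (ex_intro _ k (ex_intro _ l (And3 k0 l0 zeN))).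
Qed.

Section Action.
Variable t : seq V.
Hypothesis Rt : letters Phi t.
Let w := word aff t.
Let v := word aff (rev t).
Let gr := graded_aff_roots.
Let an := gr_aniso gr.

Lemma act_sub B : B `<=` P -> act Phi0 Delta w B `<=` P.
Proof.
move=> BP x [[[y By <-] _]|[[]]]; last by rewrite pos_rootsE.
rewrite /root_abs; case: ifPn; first by rewrite inE pos_rootsE.
have Rwy : Phi (w y) by exact: (word_root gr Rt (pos_root (BP _ By))).
by rewrite notin_setE pos_rootsE => /(posN gr Rwy).
Qed.

(** If [v x] is positive, [x] is no inversion and can only come from [v x]. If it is negative, [x]
    comes only from [- v x], and being an inversion it has its membership complemented, as in the
    half hat. *)
Lemma actE B x : B `<=` P -> P x -> act Phi0 Delta w B x <-> hat B (v x).
Proof.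
move=> BP Px; have Rv := letters_rev Rt; have Rx := pos_root Px.
have Rvx : Phi (v x) := word_root gr Rv Rx.
have wv : w (v x) = x by rewrite /w /v (word_revVK aform_psd an).
have vw y : v (w y) = y by rewrite /w /v (word_revK aform_psd an).
have invE : inversions Phi0 Delta w x <-> P (- v x).
  rewrite /inversions /= pos_rootsE (word_inv aform_psd an Rt).
  by split=> [[]|].
have absE : [set root_abs Phi0 Delta (w y) | y in B] x <-> B (v x) \/ B (- v x).
  split=> [[y By]|[Bvx|Bvx]].
  - rewrite /root_abs; case: ifP => _ <-; first by left; move: By; rewrite -{1}(vw y).
    by right; rewrite linearN opprK; move: By; rewrite -{1}(vw y).
  - exists (v x) => //; apply: etrans (congr1 (root_abs Phi0 Delta) wv) _.
    by rewrite /root_abs ifT // inE pos_rootsE.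
  - exists (- v x) => //.
    apply: etrans (congr1 (root_abs Phi0 Delta) (y := - x) _) _.
      by rewrite linearN; congr (- _); exact: wv.
    rewrite /root_abs ifF ?opprK //.
    by apply/negbTE; rewrite notin_setE pos_rootsE => /(posN gr Rx).
have disj : ~ (P (v x) /\ P (- v x)) by move=> [? /(posN gr Rvx)].
split=> [[[/absE+ /invE nP]|[/invE Pn nabs]]|].
- by move=> [Bvx|/BP//]; apply/hat_pos => //; apply: BP.
- by apply/hat_neg => // Bvx; apply: nabs; apply/absE; right.
- move=> [_ [[Pvx Bvx]|[Pvx nBvx]]].
    by left; split; [apply/absE; left | move/invE => ?; apply: disj].
  right; split; [by apply/invE | move=> /absE[/BP Pv|//]]; exact: disj.
Qed.

Lemma hat_act B x : B `<=` P -> Phi x -> hat (act Phi0 Delta w B) x <-> hat B (v x).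
Proof.
move=> BP Rx; have Rvx : Phi (v x) by exact: (word_root gr (letters_rev Rt) Rx).
have [Px|Px] := pos_dichotomy gr Rx.
  by have e1 := hat_pos (act Phi0 Delta w B) Px; have e2 := actE BP Px; tauto.
have e1 := hat_neg (act Phi0 Delta w B) Px; have := actE BP Px.
rewrite linearN => e2; have e3 := hatN B Rvx.
by split=> [/e1 h1|h]; [apply: contrapT => nh; apply: h1; apply/e2/e3 | apply/e1 => /e2/e3].
Qed.
End Action.

Lemma hat_inj B C : B `<=` P -> C `<=` P ->
  (forall x, Phi x -> hat B x <-> hat C x) -> B = C.
Proof.
move=> BP CP e; apply/seteqP; split=> x; [move=> /[dup]/BP Px | move=> /[dup]/CP Px];
  by move=> /(hat_pos _ Px)/(e _ (pos_root Px))/(hat_pos _ Px).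
Qed.

Lemma biclosed_act t B : letters Phi t -> biclosed Phi0 Delta B ->
  biclosed Phi0 Delta (act Phi0 Delta (word aff t) B).
Proof.
move=> Rt bB; have BP : B `<=` P by case: bB; rewrite pos_rootsE.
apply/biclosed_hat; first exact: act_sub.
have /(closed_half_word graded_aff_roots (letters_rev Rt)) := (biclosed_hat BP).1 bB.
suff -> : hat (act Phi0 Delta (word aff t) B) =
   [set x | hat B (word aff (rev t) x)] by [].
apply/seteqP; split=> x; first by move=> /[dup][[Rx _]] /hat_act; apply.
have gr := graded_aff_roots; move=> hB; have Rx : Phi x.
  by case: hB => + _; rewrite (word_rootE gr) //; apply: letters_rev.
by apply/hat_act.
Qed.

End Affine.

(** * Faces of the Coxeter fan and their stabilizers *)

Section Face.
Context {R : realType} {V0 : vectType R} (form : {dot V0 for idfun}).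
Variables (Phi0 : set V0) (n : nat) (Delta : n.-tuple V0) (theta : V0).
Hypotheses (rsP : root_system form Phi0) (srP : simple_roots Phi0 Delta)
  (hrP : highest_root Phi0 Delta theta).
Local Notation V := (V0 * R^o)%type.
Local Notation aff := (aform form).
Local Notation Phi := (Defs.roots Phi0).
Local Notation hA := (aff_height Delta theta).
Local Notation P := (pos Phi hA).
Implicit Types (a c : V0) (x y z : V) (s : seq V0) (t : seq V).
Variables (F : set 'Hom(V0, R^o)) (f : 'Hom(V0, R^o)).
Hypotheses (FP : fan_face form Phi0 Delta F) (fP : rel_interior Delta F f).

Let dP := dot_psd form.
Let aP := aform_psd form.
Let gA := graded_aff_roots rsP srP hrP.

Lemma finite_roots_aniso : anisotropic form Phi0.
Proof. by move=> a /(root_neq0 rsP)/form_gt0. Qed.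

Lemma weyl0_roots s a : letters Phi0 s -> Phi0 a -> Phi0 (word form s a).
Proof.
by apply: (word_root (graded_finite_roots rsP (height_int srP) (height_neq0 rsP srP))).
Qed.

(** A face lies in some chamber; the height carried to that chamber by its Weyl group element has
    the required sign property. *)
Lemma face_chamber : exists hC : 'Hom(V0, R^o), graded_roots form Phi0 hC /\
  forall g a, F g -> pos Phi0 hC a -> 0 <= g a.
Proof.
case: FP => K [[C KC] Kch] FE; have [v Wv CE] := Kch _ KC.
have an := finite_roots_aniso.
have [s Ss vE] := refl_groupP dP an Wv.
have viE : v^-1%VF = word form (rev s) by rewrite vE (word_inv dP an).
have Sr := letters_rev Ss.
exists (height Delta \o v^-1)%VF; split.
  apply: graded_finite_roots => // a Pa; rewrite comp_lfunE viE.
    by apply: (height_int srP); apply: weyl0_roots.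
  by apply: (height_neq0 rsP srP); apply: weyl0_roots.
move=> g a; rewrite FE => /(_ _ KC); rewrite CE => -[d domd <-] [Pa].
rewrite /contragredient !comp_lfunE viE => ha.
have [_ ca] : pos_roots0 Phi0 Delta (word form (rev s) a).
  by apply/(pos_roots0E rsP srP); split=> //; apply: weyl0_roots.
rewrite (coord_basis (sr_basis srP) (memvf (word form (rev s) a))) linear_sum.
by apply: sumr_ge0 => i _; rewrite linearZ /= mulr_ge0 // -tnth_nth; apply: domd.
Qed.

(** The segment from [g] to [f] can be prolonged inside [F] a little beyond [f]. At a positive root
    killed by [f], the prolonged point has value [- d * g c], while both it and [g c] are
    nonnegative. *)
Lemma face_span_root g a : F g -> Phi0 a -> f a = 0 -> g a = 0.
Proof.
have [hC [gC Cge0]] := face_chamber; have [Ff [e e0 nbh]] := fP => Fg.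
suff pos_case c : pos Phi0 hC c -> f c = 0 -> g c = 0.
  move=> Pa fa; have [Pc|Pc] := pos_dichotomy gC Pa; first exact: pos_case.
  have : g (- a) = 0 by apply: pos_case => //; rewrite linearN /= fa oppr0.
  by rewrite linearN /= => /eqP; rewrite oppr_eq0 => /eqP.
move=> Pc fc; apply/eqP; rewrite eq_le Cge0 // andbT.
pose M := \sum_i `|g (tnth Delta i) - f (tnth Delta i)|.
have M0 : 0 <= M by apply: sumr_ge0.
(* [M] dominates every coordinate of [g - f], so a step of [d] moves each coordinate by less than
   [e]; adding 1 keeps the denominator positive. *)
pose d := e / (M + 1).
have d0 : 0 < d by rewrite divr_gt0 // ltr_wpDl.
pose k := (1 + d) *: f - d *: g.
have Fk : F k.
  apply: nbh => [|i].
    exists 2, (fun i => if i == ord0 then 1 + d else - d),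
      (fun i => if i == ord0 then f else g).
    split=> [i||]; first by case: ifP.
      by rewrite big_ord_recl big_ord1 /= addrK.
    by rewrite big_ord_recl big_ord1 /= scaleNr.
  have -> : k (tnth Delta i) - f (tnth Delta i) =
      - (d * (g (tnth Delta i) - f (tnth Delta i))).
    rewrite /k add_lfunE opp_lfunE !scale_lfunE.
    rewrite -[_ *: f _]/(_ * _) -[_ *: g _]/(_ * _); ring.
  rewrite normrN normrM (gtr0_norm d0).
  apply: (@le_lt_trans _ _ (d * M)).
    rewrite ler_pM2l // /M (bigD1 i) //= lerDl.
    by apply: sumr_ge0.
  by rewrite /d mulrAC ltr_pdivrMr ?ltr_wpDl // ltr_pM2l // ltrDl.
have kc : k c = - (d * g c).
  rewrite /k add_lfunE opp_lfunE !scale_lfunE.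
  rewrite -[_ *: f _]/(_ * _) -[_ *: g _]/(_ * _) fc; ring.
by have := Cge0 _ _ Fk Pc; rewrite kc oppr_ge0 pmulr_rle0.
Qed.

Definition roots0_at : set V0 := [set a | Phi0 a /\ f a = 0].

Lemma word_fix s (g : 'Hom(V0, R^o)) a : (forall c, c \in s -> g c = 0) ->
  g (word form s a) = g a.
Proof.
elim: s => [_|c s IH gs]; first by rewrite word_nil.
rewrite word_cons reflE // linearB linearZ /= (gs c) ?mem_head // scaler0 subr0.
by apply: IH => d ds; apply: gs; rewrite inE ds orbT.
Qed.

Lemma roots0_at_fix s a : letters roots0_at s -> f (word form s a) = f a.
Proof. by move=> Ss; apply: word_fix => c /Ss[]. Qed.

Lemma pullE (g : 'Hom(V0, R^o)) x : pull g x = g x.1.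
Proof. by rewrite linfun_linE // => k u v /=; rewrite linearP. Qed.

Local Notation PhiF := (face_roots Phi0 f).

Lemma face_rootsP x : PhiF x <-> Phi x /\ f x.1 = 0.
Proof. by rewrite /face_roots /= pullE. Qed.

Lemma letters_face_fst t : letters PhiF t -> letters roots0_at (map fst t).
Proof.
by move=> Ft c /mapP[y /Ft/face_rootsP[/rootsP[Py _] fy] ->]; split.
Qed.

Lemma graded_face_roots : graded_roots aff PhiF hA.
Proof. exact: graded_roots_sub gA. Qed.

Lemma letters_face t : letters PhiF t -> letters Phi t.
Proof. by apply: letters_sub => x []. Qed.

(** The linear part [w0] permutes the roots killed by [f]. Some word [s] in their reflections
    repairs the positive roots among them, and then [s w0] preserves all positive roots of a chamber
    containing [F], so it is the identity. *)
Lemma stabilizer_linear_part t : letters Phi t ->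
  face_stabilizer form Delta theta F (word aff t) ->
  exists2 s, letters roots0_at s & word form (map fst t) = word form s.
Proof.
move=> Rt [_ stab]; have an := gr_aniso gA; have an0 := finite_roots_aniso.
set t0 := map fst t; have St0 : letters Phi0 t0 by apply: letters_fst Rt.
set w0 := word form t0; set w1 := word form (rev t0).
have w1E (x : V) : (word aff (rev t) x).1 = w1 x.1 by rewrite word_fst map_rev.
have w0E (x : V) : (word aff t x).1 = w0 x.1 by rewrite word_fst.
have w10 : cancel w0 w1 by apply: word_revK St0.
have w01 : cancel w1 w0 by apply: word_revVK St0.
have Fw1 g : F g -> exists2 g', F g' & forall a, g' a = g (w1 a).
  move=> Fg; have : (contragredient (word aff t) @` (pull (V0:=V0) @` F))
      (contragredient (word aff t) (pull g)).
    by exists (pull g) => //; exists g.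
  rewrite stab => -[g' Fg' /lfunP e]; exists g' => // a.
  have := e (a, 0); rewrite pullE /contragredient comp_lfunE pullE (word_inv aP an Rt) => ->.
  by rewrite w1E.
have Fw0 g : F g -> exists2 g', F g' & forall a, g' a = g (w0 a).
  move=> Fg; have : (pull (V0:=V0) @` F) (pull g) by exists g.
  rewrite -stab => -[_ [g' Fg' <-] /lfunP e]; exists g' => // a.
  have := e (word aff t (a, 0)).
  rewrite /contragredient comp_lfunE !pullE (word_inv aP an Rt) (word_revK aP an) // => ->.
  by rewrite w0E.
have [hC [gC Cge0]] := face_chamber; have Ff : F f := proj1 fP.
have [f0 Ff0 f0E] := Fw0 _ Ff; have [f1 Ff1 f1E] := Fw1 _ Ff.
have Psi0 a : roots0_at a -> roots0_at (w0 a).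
  by move=> [Pa fa]; split; [exact: weyl0_roots | rewrite -f0E; exact: face_span_root].
have Psi1 a : roots0_at a -> roots0_at (w1 a).
  move=> [Pa fa]; split; first by apply: weyl0_roots; first exact: letters_rev.
  by rewrite -f1E; exact: face_span_root.
have gf : graded_roots form roots0_at hC := graded_roots_sub f gC.
pose X := [set a | pos roots0_at hC (w1 a)].
have chX : closed_half roots0_at X.
  split=> [a Pa|a c d k l Pa Pc Pd Xa Xc k0 l0 de]; rewrite /X /=.
    by rewrite linearN; apply/(posN gf)/Psi1.
  apply: (ch_closed (pos_closed_half gf)
    (Psi1 _ Pa) (Psi1 _ Pc) (Psi1 _ Pd) Xa Xc k0 l0).
  by rewrite de linearD !linearZ.
have finX : finite_set (pos roots0_at hC `\` X).
  by apply: sub_finite_set (rs_finite rsP) => a [[[]]].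
have [s Ss sX] := closed_half_conj gf chX finX.
have Sf : letters roots0_at s by apply: letters_sub Ss => a /simple_root.
exists (rev s); first exact: letters_rev.
have Sf0 : letters Phi0 s by apply: letters_sub Sf => a [].
have fin_refl a : Phi0 a -> finite_set (pos Phi0 hC `\` [set y | pos Phi0 hC (refl form a y)]).
  by move=> _; apply: sub_finite_set (rs_finite rsP) => c [[]].
have id1 : word form (s ++ t0) = \1%VF.
  apply: (pos_stable_word gC fin_refl); first by apply/letters_cat.
  move=> a Pa.
  have [Ra ha] := Pa.
  have Rsa : Phi0 (word form (s ++ t0) a) by apply: weyl0_roots => //; apply/letters_cat.
  (* Where [f] vanishes, positivity is the choice of [s]. Elsewhere [f] takes at the image the value
     [f0 a], nonnegative because [f0] lies in [F], and nonzero because [w1] preserves the roots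
     killed by [f]. *)
  have [fa0|fa0] := eqVneq (f a) 0.
    have Psia : roots0_at (w0 a) by apply: Psi0.
    rewrite word_catE; have /(sX _ Psia)[[Rc _] hc] : X (w0 a); last by split.
    by rewrite /X /= w10; split.
  have fa : 0 < f (word form (s ++ t0) a).
    rewrite word_catE roots0_at_fix // -/w0 -f0E lt_def (Cge0 _ _ Ff0) // andbT.
    apply: contra_neq fa0 => f0a.
    have : roots0_at (w1 (w0 a)).
      apply: Psi1; split; first exact: weyl0_roots.
      by rewrite -f0E.
    by rewrite w10 => -[].
  have [//|Pn] := pos_dichotomy gC Rsa.
  by have := Cge0 _ _ Ff Pn; rewrite linearN /= oppr_ge0 leNgt fa.
apply/lfunP => a; have /lfunP/(_ a) := id1.
rewrite word_catE id_lfunE => e.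
by rewrite -{2}e (word_revK dP an0).
Qed.

(** * Unions of components of the face roots *)

Variable Phi' : set V.
Hypothesis Phi'P : union_of_components aff PhiF Phi'.

Lemma union_sub : Phi' `<=` PhiF.
Proof. by case: Phi'P => C Ccomp -> x [X /Ccomp[XF _ _] /XF]. Qed.

Lemma union_linked x y : PhiF x -> PhiF y -> aff x y != 0 -> Phi' x <-> Phi' y.
Proof.
have half (u v : V) : PhiF v -> aff u v != 0 -> Phi' u -> Phi' v.
  case: Phi'P => C Ccomp -> Fv uv [X CX Xu]; exists X => //.
  have [_ _ ort] := Ccomp _ CX; apply: contrapT => nXv.
  by move: uv; rewrite ort ?eqxx.
move=> Fx Fy xy; split; first exact: half.
by apply: half => //; rewrite (psdC aP).
Qed.

(** If [x] and [y] are orthogonal, [z] is orthogonal to neither; in any case [z] is not orthogonal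
    to both. So nonorthogonality links all three. *)
Lemma union_combination x y z k l : PhiF x -> PhiF y -> PhiF z ->
  0 < k -> 0 < l -> z = k *: x + l *: y ->
  (Phi' x <-> Phi' z) /\ (Phi' y <-> Phi' z).
Proof.
move=> Fx Fy Fz k0 l0 ze; have an := gr_aniso graded_face_roots.
have xy : Phi' x <-> Phi' y.
  apply: contrapT => nxy.
  have xy0 : aff x y = 0.
    by apply/eqP/negPn/negP => /(union_linked Fx Fy).
  have xz : Phi' x <-> Phi' z.
    apply: (union_linked Fx Fz); rewrite ze (bformDr aP) !(bformZr aP) xy0 mulr0 addr0.
    by rewrite mulf_neq0 ?gt_eqF // an.
  have yz : Phi' y <-> Phi' z.
    apply: (union_linked Fy Fz).
    rewrite ze (bformDr aP) !(bformZr aP) (psdC aP y x) xy0 mulr0 add0r.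
    by rewrite mulf_neq0 ?gt_eqF // an.
  by apply: nxy; tauto.
suff xz : Phi' x <-> Phi' z by tauto.
have [xz0|] := eqVneq (aff x z) 0; last exact: union_linked.
rewrite xy; apply: union_linked => //; apply/eqP => yz0.
by have := an _ Fz; rewrite {1}ze (bformDl aP) !(bformZl aP) xz0 yz0 !mulr0 addr0 ltxx.
Qed.

(** A reflection moves [c] only if its root [a] is not orthogonal to [c], and then [c], [a] and the
    image lie in one component. Levels are free because the form ignores them. *)
Lemma union_word s x y : letters roots0_at s -> PhiF x -> PhiF y ->
  y.1 = word form s x.1 -> Phi' x <-> Phi' y.
Proof.
have an := gr_aniso graded_face_roots.
elim: s y => [y _ Fx Fy|a s IH y /letters_cons[[Pa fa] Ss] Fx Fy].
  rewrite word_nil => yx; apply: union_linked => //.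
  by rewrite /aform yx gt_eqF //; exact: (an _ Fx).
rewrite word_cons; set c := word form s x.1 => ye.
have [/rootsP[Px _] fx] := (face_rootsP x).1 Fx.
have Pc : Phi0 c by apply: weyl0_roots => // d /Ss[].
have Fz : PhiF (aff_root c 0).
  apply/face_rootsP; split; first exact: roots_aff_root.
  by rewrite aff_rootE /= roots0_at_fix.
have -> : Phi' x <-> Phi' (aff_root c 0) by apply: IH => //; rewrite aff_rootE.
have Fa : PhiF (aff_root a 0).
  by apply/face_rootsP; split; [exact: roots_aff_root | rewrite aff_rootE].
have ca0 : form c c != 0 by rewrite gt_eqF // finite_roots_aniso.
have aa0 : form a a != 0 by rewrite gt_eqF // finite_roots_aniso.
have [ca|ca] := eqVneq (form c a) 0.
  apply: union_linked => //; rewrite /aform ye aff_rootE /= reflE // ca.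
  by rewrite mulr0 mul0r scale0r subr0.
have -> : Phi' (aff_root c 0) <-> Phi' (aff_root a 0).
  by apply: union_linked; rewrite // /aform !aff_rootE.
apply: union_linked => //; rewrite /aform ye aff_rootE /= (psdC dP).
suff -> : form (refl form a c) a = - form c a by rewrite oppr_eq0.
by rewrite reflE // (bformDl dP) (bformNl dP) (bformZl dP) divfK //; ring.
Qed.

Lemma unionN x : PhiF x -> Phi' (- x) <-> Phi' x.
Proof.
have gF := graded_face_roots; move=> Fx; apply: union_linked => //; first exact: (root_opp gF).
by rewrite (bformNl aP) oppr_eq0 gt_eqF // (gr_aniso gF).
Qed.

(** * The half hat of the face set and its closure *)

Let BF := face_biclosed Phi0 Delta f Phi'.
Local Notation hat := (hat Phi0 Delta theta).

Let posE := pos_rootsE rsP srP hrP.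
Let hat_posE := hat_pos rsP srP hrP.
Let hat_negE := hat_neg rsP srP hrP.

Lemma face_biclosed_sub : BF `<=` P.
Proof. by rewrite /BF /face_biclosed posE // => x [[]|[]]. Qed.

Lemma face_biclosedE x : P x -> BF x <-> f x.1 < 0 \/ Phi' x.
Proof.
rewrite /BF /face_biclosed posE // => Px.
split=> [[[_]|[]]|[fx|]]; rewrite ?pullE; try by [left | right].
by left; split=> //=; rewrite pullE.
Qed.

Lemma union_neq0 x : f x.1 != 0 -> ~ Phi' x.
Proof. by move=> fx /union_sub/face_rootsP[_]; apply/eqP. Qed.

Lemma hat_face_off x : Phi x -> f x.1 != 0 -> hat BF x <-> f x.1 < 0.
Proof.
move=> Rx fx; have [Px|Px] := pos_dichotomy gA Rx.
  rewrite hat_posE // face_biclosedE //; have := union_neq0 fx; tauto.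
rewrite hat_negE // face_biclosedE // linearN /= oppr_lt0.
have : ~ Phi' (- x) by apply: union_neq0; rewrite linearN /= oppr_eq0.
have e : f x.1 < 0 <-> ~ 0 < f x.1.
  by split=> [h|/negP]; [apply/negP; rewrite -leNgt ltW | rewrite -leNgt lt_neqAle fx].
tauto.
Qed.

Lemma hat_face_on x : Phi x -> f x.1 = 0 -> hat BF x <-> (Phi' x <-> P x).
Proof.
move=> Rx fx; have Fx : PhiF x by apply/face_rootsP.
have nff : ~ false by [].
have [Px|Px] := pos_dichotomy gA Rx.
  by rewrite hat_posE // face_biclosedE // fx ltxx; tauto.
rewrite hat_negE // face_biclosedE // linearN /= fx oppr0 ltxx unionN //.
by have := (posN gA Rx).1 Px; tauto.
Qed.

(** On the half hat [f] is nonpositive, so a sum killed by [f] has both terms killed by [f]. Then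
    all three roots are on the same side of [Phi'], where the half hat is the positive or the
    negative roots. *)
Lemma biclosed_face : biclosed Phi0 Delta BF.
Proof.
apply/(biclosed_hat rsP srP hrP face_biclosed_sub); split=> [x Rx|].
  exact: (hatN rsP srP hrP).
move=> x y z k l Rx Ry Rz Yx Yy k0 l0 ze.
have fle u : Phi u -> hat BF u -> f u.1 <= 0.
  move=> Ru Yu; have [->//|fu] := eqVneq (f u.1) 0.
  by rewrite ltW //; apply/(hat_face_off Ru fu).
have fz : f z.1 = k * f x.1 + l * f y.1 by rewrite ze /= linearD !linearZ.
have [fx fy] := (fle _ Rx Yx, fle _ Ry Yy).
have kx : k * f x.1 <= 0 by rewrite mulr_ge0_le0 // ltW.
have ly : l * f y.1 <= 0 by rewrite mulr_ge0_le0 // ltW.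
have [fz0|fz0] := eqVneq (f z.1) 0; last first.
  by apply/hat_face_off; rewrite // lt_neqAle fz0 fz -oppr_ge0 opprD addr_ge0 ?oppr_ge0.
have arith (u v : R) : u <= 0 -> v <= 0 -> u + v = 0 -> u = 0 by lra.
have fx0 : f x.1 = 0.
  have /eqP := arith _ _ kx ly (etrans (esym fz) fz0).
  by rewrite mulf_eq0 gt_eqF //= => /eqP.
have fy0 : f y.1 = 0.
  have /eqP := arith _ _ ly kx (etrans (addrC _ _) (etrans (esym fz) fz0)).
  by rewrite mulf_eq0 gt_eqF //= => /eqP.
have [Fx Fy Fz] : [/\ PhiF x, PhiF y & PhiF z] by split; apply/face_rootsP.
have [xz yz] := union_combination Fx Fy Fz k0 l0 ze.
move: Yx Yy => /(hat_face_on Rx fx0) Yx /(hat_face_on Ry fy0) Yy.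
apply/hat_face_on => //.
have PP : P x -> P y -> P z.
  by move=> Px Py; apply: (ch_closed (pos_closed_half gA)) k0 l0 ze.
have NN : ~ P x -> ~ P y -> ~ P z.
  move=> /(posN gA Rx) Px /(posN gA Ry) Py; apply/(posN gA Rz).
  apply: (ch_closed (pos_closed_half gA)
    (root_opp gA Rx) (root_opp gA Ry) (root_opp gA Rz) Px Py k0 l0).
  by rewrite ze opprD !scalerN.
by have [z'|z'] := pselect (Phi' z); tauto.
Qed.

(** * Commensurability, orbits and freeness *)

Lemma letters_linear_fix t s x : word form (map fst t) = word form s ->
  letters roots0_at s -> f (word aff t x).1 = f x.1.
Proof. by move=> ts Ss; rewrite word_fst ts roots0_at_fix. Qed.

(** The inverse of the element preserves [f] and [Phi'], so the half hat agrees at [x] and at its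
    preimage unless the preimage of the positive root [x] is negative; these [x] are finitely
    many. *)
Lemma stabilizer_orbit t s : letters Phi t -> letters roots0_at s ->
  word form (map fst t) = word form s ->
  biclosed Phi0 Delta (act Phi0 Delta (word aff t) BF) /\
  commensurable (act Phi0 Delta (word aff t) BF) BF.
Proof.
move=> Rt Ss ts; split; first exact: (biclosed_act rsP srP hrP Rt biclosed_face).
have Rr := letters_rev Rt; have BP := face_biclosed_sub.
have actP := act_sub rsP srP hrP Rt BP.
have St0 : letters Phi0 (map fst t) by apply: letters_fst Rt.
have rs : word form (map fst (rev t)) = word form (rev s).
  rewrite map_rev -(word_inv dP finite_roots_aniso St0) ts.
  by rewrite (word_inv dP finite_roots_aniso) // => a /Ss[].
apply: sub_finite_set (finite_inversions rsP srP hrP Rr) => x xD.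
have Px : P x by case: xD => -[] => [/actP|/BP].
have Rx := pos_root Px; split=> //= Pvx.
set v := word aff (rev t) in Pvx; have Rvx := pos_root Pvx.
have fv : f (v x).1 = f x.1 by apply: letters_linear_fix rs (letters_rev Ss).
have : hat BF (v x) <-> hat BF x; last first.
  rewrite -(actE rsP srP hrP Rt BP Px) (hat_posE _ Px) => e.
  by case: xD => -[] h nh; apply: nh; apply/e.
have [fx|fx] := eqVneq (f x.1) 0; last by rewrite !hat_face_off ?fv.
rewrite !hat_face_on ?fv //.
have : Phi' x <-> Phi' (v x).
  apply: (union_word (letters_rev Ss)); try by apply/face_rootsP; rewrite ?fv.
  by rewrite -rs word_fst.
tauto.
Qed.

(** A root killed by [f] is killed by all of [F], so its reflection fixes every functional of
    [F]. *)
Lemma face_weyl_stabilizer t : letters PhiF t ->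
  face_stabilizer form Delta theta F (word aff t).
Proof.
move=> Ft; have Rt := letters_face Ft; have an := gr_aniso gA.
split; first exact: (roots_weyl rsP srP hrP Rt).
have fix_pull g : F g -> contragredient (word aff t) (pull g) = pull g.
  move=> Fg; apply/lfunP => x.
  rewrite /contragredient comp_lfunE !pullE (word_inv aP an Rt) word_fst.
  apply: word_fix => c; rewrite map_rev mem_rev => /(letters_face_fst Ft)[Pc fc].
  exact: face_span_root.
apply/seteqP; split=> [_ [_ [g Fg <-] <-]|_ [g Fg <-]].
  by exists g => //; rewrite fix_pull.
by exists (pull g); [exists g | rewrite fix_pull].
Qed.

(* [B] contains [a + m d] and omits [- a + m d] for all large [m], and [x = a + k d]
   lies strictly between [a - m d] and [a + m d]. *)
Lemma hat_neg_face B x : biclosed Phi0 Delta B -> commensurable B BF ->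
  Phi x -> f x.1 < 0 -> hat B x.
Proof.
move=> bB /(finite_set_bound (@level R V0))[M DM] Rx fx.
have BP : B `<=` P by case: bB; rewrite posE.
have ch := (biclosed_hat rsP srP hrP BP).1 bB.
have [Px /intrP[k kE]] := (rootsP _ x).1 Rx; set a := x.1 in Px fx.
(* [N] exceeds the levels in the symmetric difference, so [B] and [BF] agree at level [N]; it also
   exceeds the absolute value of [k]. *)
pose N := (maxn (Num.truncn M).+1 `|k|.+1)%N.
have N1 : (0 < N)%N by rewrite leq_max.
have MN : M < N%:R.
  by apply: lt_le_trans (truncnS_gt M) _; rewrite ler_nat leq_max leqnn.
have large c : Phi0 c -> f c != 0 -> P (aff_root c N) /\ (B (aff_root c N) <-> f c < 0).
  move=> Pc fc; have Pc' : P (aff_root c N).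
    split; first exact: roots_aff_root.
    by apply: (aff_height_gt0 rsP srP hrP); rewrite /level aff_rootE // ler1z; lia.
  split=> //; have : BF (aff_root c N) <-> f c < 0.
    rewrite face_biclosedE // aff_rootE /=.
    by have /union_neq0 : f ((c, N%:~R) : V).1 != 0 by []; tauto.
  have nD : ~ (B `+` BF) (aff_root c N).
    by move=> /DM; rewrite /level aff_rootE leNgt MN.
  move=> <-; split=> h; apply: contrapT => nh; apply: nD; [left | right]; by split.
have fa0 : f a != 0 by rewrite lt_eqF.
have [Pp Bp] := large _ Px fa0.
have [|Pn Bn] := large _ (finite_rootN rsP Px); first by rewrite linearN oppr_eq0.
have nE : aff_root a (- N%:Z) = - aff_root (- a) N :> V.
  by rewrite !aff_rootE; congr pair; rewrite ?opprK // -mulrNz.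
have Hp : hat B (aff_root a N) by apply/hat_posE => //; apply/Bp.
have Hn : hat B (aff_root a (- N%:Z)).
  apply/hat_negE; rewrite nE opprK // => /Bn.
  by rewrite linearN /= oppr_lt0 => /(lt_trans fx); rewrite ltxx.
have N0 : (0 : R) < N%:R by rewrite ltr0n.
have kN : `|k%:~R : R| < N%:R.
  by rewrite -intr_norm -[N%:R]/((N%:Z)%:~R) ltr_int /N; lia.
move: kN; rewrite ltr_norml => /andP[kN1 kN2].
(* The weights [(N + k) / (2 N)] and [(N - k) / (2 N)] sum to 1 and average the levels [N] and [- N]
   to [k]. *)
apply: (ch_closed ch (roots_aff_root _ Px) (roots_aff_root _ Px) Rx Hp Hn
  (k := (N%:R + k%:~R) / (2 * N%:R)) (l := (N%:R - k%:~R) / (2 * N%:R))).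
- by rewrite divr_gt0 ?mulr_gt0 // -ltrBlDl sub0r.
- by rewrite divr_gt0 ?mulr_gt0 // subr_gt0.
rewrite !aff_rootE [LHS]surjective_pairing; congr pair => /=.
  rewrite -/a -scalerDl -{1}[a]scale1r; congr (_ *: _); field.
  by rewrite gt_eqF.
rewrite -[LHS]/(level x) kE.
rewrite -[RHS]/((N%:R + k%:~R) / (2 * N%:R) * N%:R +
  (N%:R - k%:~R) / (2 * N%:R) * (- N%:Z)%:~R) mulrNz; field.
by rewrite gt_eqF.
Qed.

Lemma hat_off_face B x : biclosed Phi0 Delta B -> commensurable B BF ->
  Phi x -> f x.1 != 0 -> hat B x <-> f x.1 < 0.
Proof.
move=> bB cB Rx fx; split; last exact: hat_neg_face.
rewrite lt_neqAle fx /= leNgt => Bx; apply/negP => fx0.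
have : hat B (- x).
  by apply: hat_neg_face => //; [exact: (root_opp gA Rx) | rewrite linearN /= oppr_lt0].
by move/(hatN rsP srP hrP B Rx).
Qed.

Lemma orbit_face_weyl B : biclosed Phi0 Delta B -> commensurable B BF ->
  exists2 t, letters PhiF t & act Phi0 Delta (word aff t) BF = B.
Proof.
move=> bB cB; have BP : B `<=` P by case: bB; rewrite posE.
have ch := (biclosed_hat rsP srP hrP BP).1 bB.
have gF := graded_face_roots; have BFP := face_biclosed_sub.
have FR x : PhiF x -> Phi x by case.
(* [X] is the half hat of [B] inside [Phi'] and its complement outside; for [BF] in place of [B] it
   would be the positive roots of [Phi_F]. *)
pose X := [set x | Phi' x <-> hat B x].
have chX : closed_half PhiF X.
  split=> [x Fx|x y z k l Fx Fy Fz Xx Xy k0 l0 ze]; rewrite /X /=.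
    rewrite unionN //; have := hatN rsP srP hrP B (FR _ Fx).
    by have [?|?] := pselect (Phi' x); tauto.
  have [xz yz] := union_combination Fx Fy Fz k0 l0 ze.
  have [Rx Ry Rz] := And3 (FR _ Fx) (FR _ Fy) (FR _ Fz).
  have HH : hat B x -> hat B y -> hat B z.
    by move=> Hx Hy; apply: (ch_closed ch) k0 l0 ze.
  have NN : ~ hat B x -> ~ hat B y -> ~ hat B z.
    move=> /(hatN rsP srP hrP B Rx) Hx /(hatN rsP srP hrP B Ry) Hy.
    apply/(hatN rsP srP hrP B Rz).
    apply: (ch_closed ch (root_opp gA Rx) (root_opp gA Ry) (root_opp gA Rz) Hx Hy k0 l0).
    by rewrite ze opprD !scalerN.
  by move: Xx Xy; rewrite /X /=; have [?|?] := pselect (Phi' z); tauto.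
(* A positive root of [Phi_F] can be missing from [X] only where [B] and [BF] differ. *)
have finX : finite_set (pos PhiF hA `\` X).
  apply: sub_finite_set cB => x [[Fx hx] nX].
  have Px : P x by split=> //; apply: FR.
  have fx : f x.1 = 0 by case/face_rootsP: Fx.
  have := face_biclosedE Px; rewrite fx ltxx => BFE.
  have [Bx|nBx] := pselect (B x); [left | right]; split=> //.
    by move=> /BFE[//|Ux]; apply: nX; rewrite /X /= hat_posE.
  apply: contrapT => nBF; apply: nX; rewrite /X /= hat_posE //.
  by have nff : ~ false by []; tauto.
have [s Ss sX] := closed_half_conj gF chX finX.
have Fs : letters PhiF s by apply: letters_sub Ss => x /simple_root.
have Rs := letters_face Fs; have Fr := letters_rev Fs; have Rr := letters_rev Rs.
exists (rev s) => //; apply: (hat_inj rsP srP hrP _ BP).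
  exact: (act_sub rsP srP hrP Rr BFP).
move=> x Rx; rewrite (hat_act rsP srP hrP Rr BFP Rx) revK.
have Rsx := word_root gA Rs Rx.
have fs : f (word aff s x).1 = f x.1.
  exact: (letters_linear_fix _ erefl (letters_face_fst Fs)).
have [fx|fx] := eqVneq (f x.1) 0; last first.
  by rewrite hat_face_off ?fs // hat_off_face.
rewrite hat_face_on ?fs //.
have Fx : PhiF x by apply/face_rootsP.
have Fsx : PhiF (word aff s x) by apply/face_rootsP; rewrite fs.
have e1 : Phi' x <-> Phi' (word aff s x).
  by apply: (union_word (letters_face_fst Fs)) => //; rewrite word_fst.
have e2 : P (word aff s x) <-> X x.
  rewrite -(sX x Fx); split=> [[_ ?]|[_ ?]]; by split.
have {}e2 : P (word aff s x) <-> (Phi' x <-> hat B x) := e2.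
by have [?|?] := pselect (Phi' x); have [?|?] := pselect (hat B x); tauto.
Qed.

(** If [w] fixes [u BF], then [r = u^-1 w^-1 u] preserves the half hat of [BF]. It also preserves
    [Phi'], so on [Phi_F] it preserves positivity and is the identity. *)
Lemma free_face_weyl (s t : seq V) : letters PhiF s -> letters PhiF t ->
  act Phi0 Delta (word aff t) (act Phi0 Delta (word aff s) BF) =
    act Phi0 Delta (word aff s) BF ->
  word aff t = \1%VF.
Proof.
move=> Fs Ft stab; have gF := graded_face_roots; have BFP := face_biclosed_sub.
have [Rs Rt] := (letters_face Fs, letters_face Ft).
have actP := act_sub rsP srP hrP Rs BFP.
have an := gr_aniso gA.
pose r := rev s ++ rev t ++ s.
have Fr : letters PhiF r.
  by apply/letters_cat; split; [|apply/letters_cat; split=> //]; apply: letters_rev.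
have Rr := letters_face Fr.
have fin_refl x : PhiF x ->
    finite_set (pos PhiF hA `\` [set y | pos PhiF hA (refl aff x y)]).
  move=> Fx; have Lx : letters PhiF [:: x] by move=> y; rewrite inE => /eqP->.
  apply: sub_finite_set (finite_inversions rsP srP hrP (letters_face Lx)).
  move=> y [[Fy hy] nP]; split; first by split=> //; case: Fy.
  rewrite -[X in ~ X]/(P (word aff [:: x] y)) word_seq1 => -[_ h]; apply: nP; split=> //.
  exact: (gr_refl gF).
have r1 : word aff r = \1%VF.
  apply: (pos_stable_word gF fin_refl Fr) => y [Fy hy].
  have Ry : Phi y by case: Fy.
  have Rsy := word_root gA Rs Ry.
  have := hat_act rsP srP hrP Rt actP Rsy; rewrite stab.
  rewrite (hat_act rsP srP hrP Rs BFP Rsy) (word_revK aP an Rs).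
  have Rtsy := word_root gA (letters_rev Rt) Rsy.
  rewrite (hat_act rsP srP hrP Rs BFP Rtsy) -!word_catE -catA -/r => e.
  have Fry := word_root gF Fr Fy.
  have [_ fy] := (face_rootsP y).1 Fy; have [Rry fry] := (face_rootsP _).1 Fry.
  have e1 : Phi' y <-> Phi' (word aff r y).
    by apply: (union_word (letters_face_fst Fr)) => //; rewrite word_fst.
  have Py : P y by [].
  have : P (word aff r y).
    have := hat_face_on Rry fry; have := hat_face_on Ry fy.
    by have [?|?] := pselect (Phi' y); have [?|?] := pselect (P (word aff r y)); tauto.
  by case=> _ ?; split.
apply/lfunP => x; rewrite id_lfunE.
have /lfunP/(_ (word aff (rev s) (word aff t x))) := r1.
rewrite id_lfunE /r !word_catE (word_revVK aP an Rs) (word_revK aP an Rt).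
by move=> /(can_inj (word_revK aP an (letters_rev Rs))).
Qed.

End Face.

Theorem theorem4p9 (R : realType) (V0 : vectType R) (form : {dot V0 for idfun})
    (Phi0 : set V0) (n : nat) (Delta : n.-tuple V0) (theta : V0)
    (F : set 'Hom(V0, R^o)) (f : 'Hom(V0, R^o))
    (Phi' : set (V0 * R^o)%type) :
  root_system form Phi0 ->
  indecomposable form Phi0 ->
  simple_roots Phi0 Delta ->
  highest_root Phi0 Delta theta ->
  fan_face form Phi0 Delta F ->
  rel_interior Delta F f ->
  union_of_components (aform form) (face_roots Phi0 f) Phi' ->
  let BF := face_biclosed Phi0 Delta f Phi' in
  let Bs := [set B | biclosed Phi0 Delta B /\ commensurable B BF] in
  [/\ Bs = orbit_of Phi0 Delta (face_stabilizer form Delta theta F) BF,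
      Bs = orbit_of Phi0 Delta (face_weyl form Phi0 f) BF &
      acts_freely_on Phi0 Delta (face_weyl form Phi0 f)
        (orbit_of Phi0 Delta (face_weyl form Phi0 f) BF)].
Proof.
move=> rsP _ srP hrP FP fP UP BF Bs.
have aP := aform_psd form.
have an := gr_aniso (graded_face_roots rsP srP hrP f).
(* Three inclusions close a cycle, giving both orbit equalities although the two groups differ in
   general. *)
have Bs_weyl : Bs `<=` orbit_of Phi0 Delta (face_weyl form Phi0 f) BF.
  move=> B [bB cB]; have [t Ft <-] := orbit_face_weyl rsP srP hrP UP bB cB.
  by exists (word (aform form) t) => //; apply: generated_word.
have weyl_stab : orbit_of Phi0 Delta (face_weyl form Phi0 f) BF `<=`
    orbit_of Phi0 Delta (face_stabilizer form Delta theta F) BF.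
  move=> _ [w /(refl_groupP aP an)[t Ft ->] <-].
  exists (word (aform form) t) => //.
  exact: (face_weyl_stabilizer rsP srP hrP FP fP Ft).
have stab_Bs : orbit_of Phi0 Delta (face_stabilizer form Delta theta F) BF `<=` Bs.
  move=> _ [w Sw <-]; have [t Rt wE] := weyl_letters rsP srP hrP Sw.1.
  move: Sw; rewrite wE => Sw.
  have [s Ss ts] := stabilizer_linear_part rsP srP hrP FP fP Rt Sw.
  exact: (stabilizer_orbit rsP srP hrP UP Rt Ss ts).
split.
- by apply/seteqP; split=> // B /Bs_weyl/weyl_stab.
- by apply/seteqP; split=> // B /weyl_stab/stab_Bs.
move=> w _ /(refl_groupP aP an)[t Ft ->] [u /(refl_groupP aP an)[s Fs ->] <-].
exact: (free_face_weyl rsP srP hrP UP Fs Ft).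
Qed.
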